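(* If $G$ is a finite connected simple outerplanar graph, then $c_{H,2}(G) \leq 2$.
   Context: The $k$-hyperopic game of cops and robber ($k \ge 1$ an integer; here $k=2$) on a finite connected simple graph $G$ is played by a team of cops (controlled by one player) and one robber, all occupying vertices of $G$. First the cops choose their starting vertices (several cops may share a vertex), then the robber chooses his starting vertex. Then the players alternate turns, cops first: on the cops' turn each cop stays or moves to an adjacent vertex; on the robber's turn he stays or moves to an adjacent vertex. The robber always sees the positions of all cops. The robber is invisible to the cops whenever every cop satisfies $1 \le d(r,c) \le k$, where $r$ and $c$ are the current positions of the robber and that cop and $d$ is graph distance; otherwise (in particular whenever some cop is at distance greater than $k$ from him) his position is known to all cops. The robber is omniscient: he knows the complete strategy of the cops in advance, so he is never captured by chance, i.e. a winning cop strategy must guarantee capture against every possible play of the robber. The cops win if after finitely many rounds some cop occupies the same vertex as the robber; otherwise the robber wins. The $k$-hyperopic cop number $c_{H,k}(G)$ is the minimum number of cops that have a winning strategy on $G$. *)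

(* Defs.v *)
From mathcomp Require Import all_boot all_order all_algebra.
From mathcomp Require Import all_classical all_reals all_analysis.

Set Implicit Arguments.
Unset Strict Implicit.
Unset Printing Implicit Defensive.

Import Order.TTheory GRing.Theory Num.Theory.
Import numFieldNormedType.Exports.

Local Open Scope classical_set_scope.
Local Open Scope ring_scope.

Record sgraph := SGraph {
  vertex :> finType;
  adj : rel vertex;
  adj_sym : symmetric adj;
  adj_irrefl : irreflexive adj }.

Arguments adj {s} : rename.

Definition connected_graph (G : sgraph) : Prop :=
  (0 < #|G|)%N /\ forall x y : G, connect (@adj G) x y.

(* Two vertices in different components get the value [#|G|], which is larger
   than any distance actually realised in [G]; only connected graphs matter. *)
Definition gdist (G : sgraph) (x y : G) : nat :=
  find (fun n => [exists p : n.-tuple G, path adj x p && (last x p == y)])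
       (iota 0 #|G|).

Section Drawing.
Variables (R : realType) (G : sgraph).

(* [arc u v], restricted to [0, 1], parametrises the edge [uv] from [u] to [v];
   [arc v u] is the same curve traversed backwards. *)
Record plane_drawing (pos : G -> R * R) (arc : G -> G -> R -> R * R) : Prop :=
  PlaneDrawing {
    pos_inj : injective pos;
    arc_continuous : forall u v, adj u v ->
      {within `[0, 1], continuous (arc u v)};
    arc_inj : forall u v, adj u v -> {in `[0, 1] &, injective (arc u v)};
    arc_source : forall u v, adj u v -> arc u v 0 = pos u;
    arc_target : forall u v, adj u v -> arc u v 1 = pos v;
    arc_rev : forall u v t, adj u v -> 0 <= t <= 1 -> arc v u t = arc u v (1 - t);
    arc_avoids_vertices : forall u v w t, adj u v -> 0 < t < 1 ->
      arc u v t <> pos w;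
    arc_disjoint : forall u v u' v' s t, adj u v -> adj u' v' ->
      [set u; v]%SET <> [set u'; v']%SET ->
      0 < s < 1 -> 0 < t < 1 -> arc u v s <> arc u' v' t }.

Definition drawing_support (pos : G -> R * R) (arc : G -> G -> R -> R * R) :
    set (R * R) :=
  range pos `|`
  [set p | exists u v t, [/\ adj u v, 0 <= t <= 1 & p = arc u v t]].

Definition face (pos : G -> R * R) (arc : G -> G -> R -> R * R)
    (F : set (R * R)) : Prop :=
  exists2 p, (~` drawing_support pos arc) p &
    F = connected_component (~` drawing_support pos arc) p.

(* The support is compact, so exactly one face is unbounded. *)
Definition outer_face (pos : G -> R * R) (arc : G -> G -> R -> R * R)
    (F : set (R * R)) : Prop :=
  face pos arc F /\ ~ bounded_set F.

Definition outerplanar : Prop :=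
  exists pos arc, plane_drawing pos arc /\
    exists2 F, outer_face pos arc F & forall v, closure F (pos v).

End Drawing.

Arguments outerplanar R G : clear implicits.

Section Game.
Variables (G : sgraph) (k m : nat).

Definition cops := {ffun 'I_m -> G}.

Definition stay_or_move (x y : G) : bool := (y == x) || adj x y.

Definition invisible (C : cops) (r : G) : bool :=
  [forall i, 1 <= gdist r (C i) <= k]%N.

(* What the cops know of a position: their own vertices, and the robber's
   vertex when he is visible. *)
Definition view : Type := (cops * option G)%type.

Definition view_of (C : cops) (r : G) : view :=
  (C, if invisible C r then None else Some r).

(* [next h] is the cops' position after their next move, when [h] lists all
   past views, most recent first. *)
Record strategy := Strategy {
  start : cops;
  next : seq view -> cops;
  next_legal : forall (w : view) (h : seq view) (i : 'I_m),
    stay_or_move (w.1 i) (next (w :: h) i) }.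

(* [r t] is the robber's vertex after his [t]-th move. *)
Definition robber_play (r : nat -> G) : Prop :=
  forall t, stay_or_move (r t) (r t.+1).

(* The position of the cops after their [t]-th move and the views seen up to
   and including the robber's [t]-th move. Visibility depends on the current
   positions, so there is a view after each half-round. *)
Fixpoint run (s : strategy) (r : nat -> G) (t : nat) : cops * seq view :=
  if t is t'.+1 then
    let h := (run s r t').2 in
    let C := next s h in
    (C, view_of C (r t'.+1) :: view_of C (r t') :: h)
  else (start s, [:: view_of (start s) (r 0)]).

Definition captured (s : strategy) (r : nat -> G) : Prop :=
  exists t i, (run s r t).1 i = r t \/ (run s r t.+1).1 i = r t.

(* A deterministic strategy that beats every robber play: the robber, knowing
   the strategy in advance, could otherwise select a play that defeats it. *)
Definition winning (s : strategy) : Prop :=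
  forall r, robber_play r -> captured s r.

Definition cops_win : Prop := exists s : strategy, winning s.

End Game.

Lemma cops_win_card (G : sgraph) (k : nat) : exists m, `[< cops_win G k m >].
Proof.
exists #|G|; apply/asboolP.
pose C : cops G #|G| := [ffun i => enum_val i].
have leg (w : view G #|G|) (h : seq (view G #|G|)) i :
    stay_or_move (w.1 i) ((if w :: h is w' :: _ then w'.1 else C) i).
  by rewrite /stay_or_move eqxx.
exists (@Strategy G #|G| C (fun h => if h is w :: _ then w.1 else C) leg) => r _.
by exists 0%N, (enum_rank (r 0%N)); left; rewrite /= ffunE enum_rankK.
Qed.

(* The least number of cops with a winning strategy. *)
Definition hyperopic_cop_number (G : sgraph) (k : nat) : nat :=
  ex_minn (cops_win_card G k).

(* Main.v *)
Require Import Defs.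
From mathcomp Require Import all_boot all_order all_algebra.
From mathcomp Require Import all_classical all_reals all_analysis.
From mathcomp Require Import zify lra.
From Stdlib Require Import Btauto.

Set Implicit Arguments.
Unset Strict Implicit.
Unset Printing Implicit Defensive.

(** Why the theorem is true.

    An outerplanar drawing orders the vertices so that no two edges cross:
    no vertices x < y < z < t have both edges xz and yt
    ([outerplanar_noncrossing]). Two cops then win by shrinking the interval
    of this order in which the robber can be ([win_region]).

    The order. Take a point p of the outer face and join it inside the face to
    points next to every vertex. After rounding to a fine grid each edge is a
    walk of grid points, walks of disjoint edges are disjoint, and the walks
    from p form a tree whose branch to v meets only the edges at v. The one
    fact about the plane that is needed is a parity identity: for two disjoint
    grid walks, the total number of times that one of them passes below an end
    of the other is determined modulo 2 by the lexicographic order of the ends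
    ([ray_parity_walks]). These parities define which of two branches comes
    first ([before]). By the identity the answer depends only on how the two
    branches part, so this is a linear order ([before_trans]); and the identity
    applied to two disjoint edges and to the branches to their four ends shows
    that the ends of one edge do not separate those of the other
    ([before_edges]).

    The game. Cops at a and b confine the robber to a set s that lies between
    them in the order and that can be left only through a and b ([region]). If
    one of a and b has no neighbour in s, the cop at the other suffices as a
    guard, and the idle cop walks to a neighbour of the guard in s. Otherwise
    let u be the last neighbour of a in s. If u is the only one, the cop at a
    moves to u, and u can be moved to the front of the order. If there are
    more, the cop at a makes a feint: he steps to a neighbour p in s and
    returns. While he is at p the robber is visible if he is at distance more
    than 2 from p, which tells the cops on which side of some vertex w the
    robber is, and w bounds a smaller region ([win_feint]). No feint is
    available only if u is adjacent to both a and b and every other neighbour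
    of a or b in s is adjacent to u. But then the robber is invisible only at
    u and next to u, and the cops sweep the neighbours of u one after the
    other, always ready to recapture u ([win_fan]). *)

(** * Crossing parity of grid walks *)

Section GridWalks.
Import Order.TTheory GRing.Theory Num.Theory.
Local Open Scope ring_scope.

Definition pt := (int * int)%type.

Definition lex (a b : pt) : bool := (a.1 < b.1) || ((a.1 == b.1) && (a.2 < b.2)).

Definition step (a b : pt) : bool :=
  ((a.1 == b.1) && ((b.2 == a.2 + 1) || (a.2 == b.2 + 1))) ||
  ((a.2 == b.2) && ((b.1 == a.1 + 1) || (a.1 == b.1 + 1))).

(** The order [lex] puts a slightly tilted vertical line through q: the points
    after q are on its right. A step [a], [b] that avoids q and changes sides is
    horizontal, so the height of [a] tells whether it passes below q. *)
Definition ray_hit (q a b : pt) : bool := (lex q a (+) lex q b) && (a.2 < q.2).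

Fixpoint ray_parity (q a : pt) (s : seq pt) : bool :=
  if s is b :: s' then ray_hit q a b (+) ray_parity q b s' else false.

Lemma lexN a b : a != b -> lex b a = ~~ lex a b.
Proof. case: a b => [a1 a2] [b1 b2]; rewrite /lex xpair_eqE /=; lia. Qed.

Lemma step_sym a b : step a b = step b a.
Proof. by rewrite /step; lia. Qed.

Lemma ray_hitC q a b : q != a -> q != b -> step a b -> ray_hit q a b = ray_hit q b a.
Proof.
case: a b q => [a1 a2] [b1 b2] [q1 q2]; rewrite /ray_hit /step /lex !xpair_eqE /=; lia.
Qed.

Lemma stepP a b :
  reflect (exists d : int * int, [/\ d \in [:: (0, 1); (0, -1); (1, 0); (-1, 0)] &
             b = (a.1 + d.1, a.2 + d.2)])
          (step a b).
Proof.
apply: (iffP idP).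
  case: a b => [a1 a2] [b1 b2]; rewrite /step /=.
  case/orP => /andP[/eqP h /orP[]/eqP k].
  - by exists (0,1); rewrite k h addr0.
  - by exists (0,-1); rewrite k h addr0 addrK.
  - by exists (1,0); rewrite k h addr0.
  - by exists (-1,0); rewrite k h addr0 addrK.
case=> d [+ ->]; rewrite !inE => /or4P[]/eqP-> /=; rewrite /step /=;
  case: a => a1 a2 /=; lia.
Qed.

(** The differences of the two moving points run around a unit square, possibly
    flattened, that misses the origin, hence do not wind around it. The
    right-hand side appears because half of the terms look from [a] to [b] and
    the others from [b] to [a], where passing below becomes passing above. *)
Lemma ray_hit_square a a' b b' : step a a' -> step b b' ->
  a != b -> a != b' -> a' != b -> a' != b' ->
  ray_hit b a a' (+) ray_hit b' a a' (+) (ray_hit a b b' (+) ray_hit a' b b') =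
  lex b a (+) lex b' a (+) (lex b a' (+) lex b' a').
Proof.
case: a a' b b' => [a1 a2] [c1 c2] [b1 b2] [d1 d2].
move=> /stepP[d [hd ->]] /stepP[e [he ->]].
have -> : a1 = b1 + (a1 - b1) by lia. have -> : a2 = b2 + (a2 - b2) by lia.
move: (a1 - b1) (a2 - b2) => x y.
move: hd he; rewrite !inE => /or4P[]/eqP-> /or4P[]/eqP->.
all: rewrite /ray_hit /lex !xpair_eqE /=.
all: lia.
Qed.

Definition avoids (s t : seq pt) : Prop := forall x, x \in s -> x \notin t.

Lemma avoids_sym s t : avoids s t -> avoids t s.
Proof. by move=> h x xt; apply/negP => /h; rewrite xt. Qed.

Lemma avoids_cons s y t : avoids s (y :: t) <-> y \notin s /\ avoids s t.
Proof.
split=> [h|[ys h] x xs]; last by rewrite inE negb_or h // andbT; apply: contraNneq ys => <-.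
split; first by apply/negP => /h; rewrite inE eqxx.
by move=> x /h; rewrite inE negb_or => /andP[].
Qed.

Lemma addb_xorb a b : a (+) b = xorb a b.
Proof. by case: a; case: b. Qed.

Lemma eq_xor1 a b c d : a = b -> xorb a b = xorb c d -> c = d.
Proof. by move=> ->; case: b c d => [] [] []. Qed.

Lemma eq_xor2 a b c d e f :
  a = b -> c = d -> xorb (xorb a b) (xorb c d) = xorb e f -> e = f.
Proof. by move=> -> ->; case: b d e f => [] [] [] []. Qed.

Ltac xor_from1 H := apply: (eq_xor1 H); rewrite ?addb_xorb; btauto.
Ltac xor_from2 H K := apply: (eq_xor2 H K); rewrite ?addb_xorb; btauto.
Lemma ray_parity_cat q a s t :
  ray_parity q a (s ++ t) = ray_parity q a s (+) ray_parity q (last a s) t.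
Proof. by elim: s a => //= b s IH a; rewrite IH addbA. Qed.

(** Moving the base point of the ray along a step away from the walk changes the
    parity only by what happens at the two ends of the walk. *)
Lemma ray_parity_step (b b' a : pt) (s : seq pt) : step b b' -> path step a s ->
  b \notin a :: s -> b' \notin a :: s ->
  ray_parity b a s (+) ray_parity b' a s =
  (ray_hit a b b' (+) ray_hit (last a s) b b') (+)
  (lex b a (+) lex b' a (+) (lex b (last a s) (+) lex b' (last a s))).
Proof.
move=> sb; elim: s a => [|a' s IH] a /=; first by rewrite !addbb.
case/andP=> sa ps; rewrite !inE !negb_or.
move=> /andP[ba /andP[ba' bs]] /andP[b'a /andP[b'a' b's]].
have := IH a' ps; rewrite !inE !negb_or ba' b'a' bs b's => /(_ isT isT) IHs.
have := ray_hit_square sa sb; rewrite ![a == _]eq_sym ![a' == _]eq_sym.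
move=> /(_ ba b'a ba' b'a') sq.
by xor_from2 IHs sq.
Qed.

(** Two closed curves cross an even number of times; this is that fact for walks
    that are closed up along vertical rays. It takes the place of the Jordan curve
    theorem. *)
Lemma ray_parity_walks (a : pt) (s : seq pt) (b : pt) (t : seq pt) :
  path step a s -> path step b t -> avoids (a :: s) (b :: t) ->
  ray_parity b a s (+) ray_parity (last b t) a s (+)
    (ray_parity a b t (+) ray_parity (last a s) b t) =
  lex b a (+) lex (last b t) a (+) (lex b (last a s) (+) lex (last b t) (last a s)).
Proof.
move=> pa; elim: t b => [|b' t IH] b; first by rewrite /= !addbb.
move=> /= /andP[sb pt] /avoids_cons[nb nt].
have IHs := IH b' pt nt; move: nt => /avoids_cons[nb' _].
have st := ray_parity_step sb pa nb nb'.
by xor_from2 IHs st.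
Qed.

(** * The order of the branches of a star *)

(** The first line compares the ends and counts modulo 2 how often each walk passes
    below the end of the other. The second line cuts the angle around p open, which
    makes the value insensitive to prolonging the walks ([before_rcons]). *)
Definition before (p : pt) (s t : seq pt) : bool :=
  let u := last p s in let x := last p t in
  lex u x (+) (ray_parity x p s (+) ray_parity u p t) (+)
  (ray_parity p p s (+) lex u p (+) (ray_parity p p t (+) lex x p)).

Lemma beforeN (p : pt) (s t : seq pt) :
  last p s != last p t -> before p t s = ~~ before p s t.
Proof.
move=> h; have E : lex (last p t) (last p s) = ~~ lex (last p s) (last p t) by apply: lexN.
by rewrite /before E !addb_xorb; btauto.
Qed.

Lemma before_rcons (p : pt) (s t : seq pt) (b : pt) :
  path step p s -> path step p (rcons t b) ->
  last p t \notin p :: s -> b \notin p :: s ->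
  before p s (rcons t b) = before p s t.
Proof.
move=> ps; rewrite rcons_path => /andP[_ sb] nx nb.
rewrite /before last_rcons -cats1 !ray_parity_cat /= !addbF.
have st := ray_parity_step sb ps nx nb.
have ux : last p s != last p t.
  by apply: contraNneq nx => <-; apply: mem_last.
have ub : last p s != b by apply: contraNneq nb => <-; apply: mem_last.
have E1 : lex (last p t) (last p s) = ~~ lex (last p s) (last p t) by apply: lexN.
have E2 : lex b (last p s) = ~~ lex (last p s) b by apply: lexN.
rewrite E1 E2 in st; xor_from1 st.
Qed.

Lemma before_cat (p : pt) (s t t' : seq pt) : path step p s -> path step p (t ++ t') ->
  last p t \notin p :: s -> avoids (p :: s) t' ->
  before p s (t ++ t') = before p s t.
Proof.
move=> ps; elim: t' t => [|b t' IH] t; first by rewrite cats0.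
rewrite -cat_rcons => pt nx /avoids_cons[nb nt'].
rewrite IH ?last_rcons // before_rcons //.
by move: pt; rewrite cat_path => /andP[].
Qed.

(** The value of [before] at two children [k], [l] of a node [h] with parent [g];
    [root_turn] is the same at the root. *)
Definition turn (g h k l : pt) : bool :=
  lex k l (+) (ray_hit l g h (+) ray_hit k g h) (+) (ray_hit l h k (+) ray_hit k h l) (+)
  (lex k g (+) lex l g) (+) (ray_hit g k h (+) ray_hit g h l).

Definition root_turn (h k l : pt) : bool :=
  lex k l (+) (ray_hit l h k (+) ray_hit k h l) (+) (lex k h (+) lex l h).

Lemma before_root p k l : before p [:: k] [:: l] = root_turn p k l.
Proof.
rewrite /before /root_turn /=.
have E x : ray_hit p p x = false by rewrite /ray_hit ltxx andbF.
rewrite !E /= !addb_xorb; btauto.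
Qed.

(** The identity for the walk to [g] and the two-step walk from [k] to [l] removes
    every term that is not local at [h]. *)
Lemma before_turn (p : pt) (b : seq pt) (h k l : pt) :
  path step p (rcons b h) -> step h k -> step h l ->
  h \notin p :: b -> k \notin p :: b -> l \notin p :: b ->
  before p (rcons (rcons b h) k) (rcons (rcons b h) l) = turn (last p b) h k l.
Proof.
rewrite rcons_path => /andP[pb sgh] shk shl hb kb lb.
have pw : path step k [:: h; l] by rewrite /= step_sym shk shl.
have nw : avoids (p :: b) [:: k; h; l] by rewrite !avoids_cons.
have E := ray_parity_walks pb pw nw.
move: E; rewrite /before /turn !last_rcons -!cats1 !ray_parity_cat !last_cat /= !addbF => E.
have K : ray_hit p k h = ray_hit p h k.
  move: kb hb; rewrite !inE !negb_or => /andP[kp _] /andP[hp _].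
  by apply: ray_hitC; rewrite 1?eq_sym // step_sym.
rewrite K in E; xor_from1 E.
Qed.

Lemma lex_shift (h d e : pt) : lex (h.1 + d.1, h.2 + d.2) (h.1 + e.1, h.2 + e.2) = lex d e.
Proof. rewrite /lex /=; lia. Qed.

Lemma ray_hit_shift (h c d e : pt) :
  ray_hit (h.1 + c.1, h.2 + c.2) (h.1 + d.1, h.2 + d.2) (h.1 + e.1, h.2 + e.2) =
  ray_hit c d e.
Proof. rewrite /ray_hit !lex_shift /=; congr (_ && _); lia. Qed.

Lemma root_turn_trans h k l m : step h k -> step h l -> step h m ->
  k != l -> l != m -> k != m ->
  root_turn h k l -> root_turn h l m -> root_turn h k m.
Proof.
move=> /stepP[d [hd ->]] /stepP[e [he ->]] /stepP[f [hf ->]].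
have rE x y :
    root_turn h (h.1 + x.1, h.2 + x.2) (h.1 + y.1, h.2 + y.2) = root_turn (0, 0) x y.
  have hE : h = (h.1 + (0 : int, 0 : int).1, h.2 + (0 : int, 0 : int).2).
    by case: h => h1 h2 /=; rewrite !addr0.
  rewrite {1}hE.
  by rewrite /root_turn !ray_hit_shift !lex_shift.
rewrite !rE.
move: hd he hf; rewrite !inE => /or4P[]/eqP-> /or4P[]/eqP-> /or4P[]/eqP->.
all: by rewrite ?eqxx.
Qed.

Lemma turn_trans g h k l m : step h g -> step h k -> step h l -> step h m ->
  k != g -> l != g -> m != g -> k != l -> l != m -> k != m ->
  turn g h k l -> turn g h l m -> turn g h k m.
Proof.
move=> /stepP[c [hc ->]] /stepP[d [hd ->]] /stepP[e [he ->]] /stepP[f [hf ->]].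
have rE x y : turn (h.1 + c.1, h.2 + c.2) h (h.1 + x.1, h.2 + x.2) (h.1 + y.1, h.2 + y.2) =
    turn c (0, 0) x y.
  have hE : h = (h.1 + (0 : int, 0 : int).1, h.2 + (0 : int, 0 : int).2).
    by case: h => h1 h2 /=; rewrite !addr0.
  rewrite {3}hE.
  by rewrite /turn !ray_hit_shift !lex_shift.
rewrite !rE.
move: hc hd he hf; rewrite !inE => /or4P[]/eqP-> /or4P[]/eqP-> /or4P[]/eqP-> /or4P[]/eqP->.
all: by rewrite ?eqxx.
Qed.

(** The two continuations [s], [t] of a common part [b] agree for a while and are
    disjoint after that; neither is a prefix of the other. *)
Fixpoint fork (b s t : seq pt) : Prop :=
  match s, t with
  | h :: s', k :: t' =>
    if h == k then fork (rcons b h) s' t' else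
    [/\ avoids b s, avoids b t & avoids s t]
  | _, _ => False
  end.

Lemma fork_split b h s k t : h != k -> fork b (h :: s) (k :: t) ->
  [/\ avoids b (h :: s), avoids b (k :: t) & avoids (h :: s) (k :: t)].
Proof. by move=> /= /negPf->. Qed.

Lemma fork_last b (p : pt) s t : fork b s t -> last p s != last p t.
Proof.
elim: s t b p => [|h s IH] [|k t] b p //=.
case: eqP => [->|hk]; first exact: IH.
by case=> _ _ nn; apply: contraTneq (mem_last h s) => ->; apply: avoids_sym nn _ (mem_last _ _).
Qed.

Lemma avoids_catl b s t : avoids b t -> avoids s t -> avoids (b ++ s) t.
Proof. by move=> bt st x; rewrite mem_cat => /orP[/bt|/st]. Qed.

(** Once the walks have parted they keep clear of each other, so [before_cat]
    shortens both to the first step after the fork. *)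
Lemma before_fork (p : pt) (b : seq pt) h s k t : h != k ->
  path step p (b ++ h :: s) -> path step p (b ++ k :: t) ->
  fork (p :: b) (h :: s) (k :: t) ->
  before p (b ++ h :: s) (b ++ k :: t) = before p (rcons b h) (rcons b k).
Proof.
move=> hk ps pt /(fork_split hk)[nh nk nn].
have pb' : path step p (rcons b k) by move: pt; rewrite -cat_rcons cat_path => /andP[].
have N : avoids (p :: b ++ h :: s) (k :: t) by rewrite -cat_cons; apply: avoids_catl.
have /avoids_cons[kN tN] := N.
rewrite -[b ++ k :: t]cat_rcons before_cat ?cat_rcons ?last_rcons //.
have lh : last p (b ++ h :: s) != last p (rcons b k).
  by rewrite last_rcons; apply: contraNneq kN => <-; apply: mem_last.
have kh : last p (rcons b h) != last p (rcons b k) by rewrite !last_rcons.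
apply: negb_inj; rewrite -(beforeN lh) -(beforeN kh) -cat_rcons.
rewrite before_cat ?cat_rcons ?last_rcons //.
  have /avoids_cons[hb _] := nh; rewrite -rcons_cons mem_rcons inE negb_or hk /=.
  exact: hb.
have /avoids_cons[_ sb] := nh; have /avoids_cons[_ sk] := avoids_sym nn.
move=> x; rewrite -rcons_cons mem_rcons inE => /predU1P[->|/sb//].
by have := avoids_sym nn (mem_head _ _); rewrite inE negb_or => /andP[].
Qed.

Lemma before_fork_step (p : pt) (b : seq pt) h k l s1 s2 s3 :
  h != k -> k != l -> h != l ->
  path step p (b ++ h :: s1) -> path step p (b ++ k :: s2) -> path step p (b ++ l :: s3) ->
  uniq (p :: b) ->
  avoids (p :: b) [:: h; k; l] ->
  before p (rcons b h) (rcons b k) -> before p (rcons b k) (rcons b l) ->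
  before p (rcons b h) (rcons b l).
Proof.
move=> hk kl hl; rewrite -!cat_rcons !cat_path => /andP[+ _] /andP[+ _] /andP[+ _].
case/lastP: b => [|b m].
  rewrite /= !andbT !before_root => ph pk pl _ _.
  exact: root_turn_trans.
move=> ph pk pl; rewrite -rcons_cons rcons_uniq => /andP[mb _].
have sp x : x \notin p :: rcons b m -> x \notin p :: b.
  by apply: contraNN; rewrite -rcons_cons mem_rcons inE orbC => ->.
case/avoids_cons=> /sp H /avoids_cons[/sp K /avoids_cons[/sp L _]].
have [pb sh] : path step p (rcons b m) /\ step m h.
  by move: ph; rewrite rcons_path last_rcons => /andP[].
have sk : step m k by move: pk; rewrite rcons_path last_rcons => /andP[].
have sl : step m l by move: pl; rewrite rcons_path last_rcons => /andP[].
have sg : step m (last p b) by rewrite step_sym; move: pb; rewrite rcons_path => /andP[].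
rewrite !before_turn //; apply: turn_trans => //.
- by apply: contraNneq H => ->; apply: mem_last.
- by apply: contraNneq K => ->; apply: mem_last.
- by apply: contraNneq L => ->; apply: mem_last.
Qed.

(** If two of the three walks part from the third at the same place and stay
    together longer, the third compares in the same way with both. Otherwise all
    three part at one node and [turn_trans] applies. *)
Lemma before_trans (p : pt) (b s t u : seq pt) :
  path step p (b ++ s) -> path step p (b ++ t) -> path step p (b ++ u) ->
  uniq (p :: b ++ s) ->
  fork (p :: b) s t -> fork (p :: b) t u -> fork (p :: b) s u ->
  before p (b ++ s) (b ++ t) -> before p (b ++ t) (b ++ u) -> before p (b ++ s) (b ++ u).
Proof.
elim: s t u b => [|h s IH] [|k t] [|l u] b //= ps pt pu us.
case: (eqVneq h k) pt => [<-{k}|hk] pt; case: (eqVneq h l) pu => [<-{l}|hl] pu.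
- rewrite -!cat_rcons; apply: IH; rewrite ?cat_rcons //.
- move=> fst ftu fsu.
  by rewrite (before_fork hl) ?(before_fork (s := s) hl) //= (negPf hl).
- move=> fst ftu fsu.
  have kh : k != h by rewrite eq_sym.
  rewrite (before_fork hk) ?(before_fork kh) //= ?(negPf hk) ?(negPf kh) //.
  have kh' : last p (rcons b h) != last p (rcons b k) by rewrite !last_rcons.
  by rewrite (beforeN kh') => ->.
case: (eqVneq k l) pt => [<-{l}|kl] pt in pu hl *.
  move=> fst ftu fsu.
  by rewrite (before_fork hk) ?(before_fork (t := u) hk) //= (negPf hk).
move=> fst ftu fsu.
rewrite (before_fork hk) ?(before_fork kl) ?(before_fork hl) //=
  ?(negPf hk) ?(negPf kl) ?(negPf hl) //.
apply: (before_fork_step hk kl hl ps pt pu).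
  by move: us; rewrite /= mem_cat negb_or cat_uniq => /andP[/andP[-> _] /and3P[-> _ _]].
case: fst => /avoids_cons[hb _] /avoids_cons[kb _] _; case: ftu => _ /avoids_cons[lb _] _.
by rewrite !avoids_cons.
Qed.

Definition noncrossing (V : eqType) (e : rel V) (l : seq V) : Prop :=
  forall x y z t, subseq [:: x; y; z; t] l -> e x z -> e y t -> False.

(** Add up the identity for the two edges and for each of the four pairs of an
    edge and a branch to an end of the other edge: every count that involves an
    edge occurs twice. *)
Lemma before_edges (p : pt) (su sv sx sy e f : seq pt) :
  path step p su -> path step p sv -> path step p sx -> path step p sy ->
  path step (last p su) e -> last (last p su) e = last p sv ->
  path step (last p sx) f -> last (last p sx) f = last p sy ->
  avoids (last p su :: e) (last p sx :: f) ->
  avoids (p :: su) (last p sx :: f) -> avoids (p :: sv) (last p sx :: f) ->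
  avoids (p :: sx) (last p su :: e) -> avoids (p :: sy) (last p su :: e) ->
  before p su sx (+) before p su sy (+) (before p sv sx (+) before p sv sy) = false.
Proof.
move=> pu pv px py pe le pf lf def duf dvf dxe dye.
have Eef := ray_parity_walks pe pf def.
have Euf := ray_parity_walks pu pf duf; have Evf := ray_parity_walks pv pf dvf.
have Exe := ray_parity_walks px pe dxe; have Eye := ray_parity_walks py pe dye.
rewrite le lf in Eef; rewrite lf in Euf Evf; rewrite le in Exe Eye.
have ne (a b : seq pt) : avoids (p :: a) (last p b :: f) ->
    lex (last p b) (last p a) = ~~ lex (last p a) (last p b).
  move=> d; apply: lexN; apply: contraTneq (mem_last p a) => ->.
  by apply: (avoids_sym d); apply: mem_head.
have ney (a : seq pt) : avoids (p :: a) (last p sx :: f) ->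
    lex (last p sy) (last p a) = ~~ lex (last p a) (last p sy).
  move=> d; apply: lexN; apply: contraTneq (mem_last p a) => ->; apply: (avoids_sym d).
  by rewrite -lf; apply: mem_last.
have Xux := ne _ _ duf; have Xvx := ne _ _ dvf; have Xuy := ney _ duf; have Xvy := ney _ dvf.
rewrite Xux Xvx Xuy Xvy in Eef Euf Evf.
have E := f_equal2 xorb Eef (f_equal2 xorb (f_equal2 xorb Euf Evf) (f_equal2 xorb Exe Eye)).
by rewrite /before; xor_from1 E.
Qed.

(** The vertices are sorted by their branches. If x < y < z < t then exactly one
    of the four comparisons in [before_edges] for xz and yt is false. *)
Lemma noncrossing_of_star (V : finType) (e : rel V) (p : pt) (st : V -> seq pt)
    (w : V -> V -> seq pt) :
  (forall v, path step p (st v)) -> (forall v, uniq (p :: st v)) ->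
  (forall u v, u != v -> fork [:: p] (st u) (st v)) ->
  (forall u v, e u v -> path step (last p (st u)) (w u v)) ->
  (forall u v, e u v -> last (last p (st u)) (w u v) = last p (st v)) ->
  (forall u v x y, e u v -> e x y -> uniq [:: u; v; x; y] ->
     avoids (last p (st u) :: w u v) (last p (st x) :: w x y)) ->
  (forall u v x, e u v -> x \notin [:: u; v] ->
     avoids (p :: st x) (last p (st u) :: w u v)) ->
  exists l : seq V, [/\ uniq l, forall v, v \in l & noncrossing e l].
Proof.
move=> pst ust fst pw lw dw ds.
pose R (u v : V) := (u == v) || before p (st u) (st v).
have lne u v : u != v -> last p (st u) != last p (st v) by move=> /fst; apply: fork_last.
have Rtot : total R.
  move=> u v; rewrite /R [v == u]eq_sym; case: eqVneq => //= uv.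
  by rewrite [before p (st v) _](beforeN (lne _ _ uv)) orbN.
have Rtr : transitive R.
  move=> v u x; rewrite /R; case: (eqVneq u v) => [->//|uv] /=.
  case: (eqVneq v x) => [->|vx] /= h1 h2; first by rewrite h1 orbT.
  case: (eqVneq u x) => [//|ux] /=.
  by apply: (@before_trans p [::] _ (st v)) => //=; try exact: ust; apply: fst.
have Ranti u v : u != v -> before p (st v) (st u) = ~~ before p (st u) (st v).
  by move=> uv; apply: beforeN; apply: lne.
exists (sort R (enum V)); split; first by rewrite sort_uniq enum_uniq.
  by move=> v; rewrite mem_sort mem_enum.
move=> x y z t sub exz eyt.
have srt : sorted R [:: x; y; z; t].
  by apply: (subseq_sorted Rtr sub); apply: sort_sorted.
have unq : uniq [:: x; y; z; t].
  by apply: subseq_uniq sub _; rewrite sort_uniq enum_uniq.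
move: srt; rewrite (sorted_pairwise Rtr) /=.
move=> /and4P[/and4P[xy _ xt _] /and3P[yz _ _] /andP[zt _] _].
move: (unq) => /=; rewrite !inE !negb_or => /and4P[/and3P[nxy nxz nxt] /andP[nyz nyt] nzt _].
have unq' : uniq [:: x; z; y; t].
  by move: unq; rewrite /= !inE !negb_or [z == y]eq_sym nxy nxz nxt nyz nyt nzt.
have := before_edges (pst x) (pst z) (pst y) (pst t)
  (pw _ _ exz) (lw _ _ exz) (pw _ _ eyt) (lw _ _ eyt).
move=> /(_ (dw _ _ _ _ exz eyt unq')).
do 4 (move/(_ (ds _ _ _ _ _)); rewrite ?exz ?eyt ?inE ?negb_or; 
  rewrite ?[z == y]eq_sym ?[y == x]eq_sym ?[t == x]eq_sym ?[t == z]eq_sym;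
  rewrite ?nxy ?nxz ?nxt ?nyz ?nyt ?nzt => /(_ isT isT)).
move: xy xt yz zt; rewrite /R (negPf nxy) (negPf nxt) (negPf nyz) (negPf nzt) /= => -> -> yz ->.
by rewrite (Ranti _ _ nyz) yz.
Qed.

(** * Trees of grid walks *)

(** [P z] lists the points after p on the branch to [z]; the last condition says
    that a branch through [w] begins with the branch to [w]. *)
Definition tree (p : pt) (D : seq pt) (P : pt -> seq pt) : Prop :=
  p \in D /\ forall z, z \in D ->
  [/\ path step p (P z), last p (P z) = z, uniq (p :: P z) &
      forall w, w \in p :: P z -> w \in D /\ prefix (P w) (P z)].

(** Follow the walk from the tree and hang every new point on the preceding one.
    The set [E] records where the branches to the points of the walk run. *)
Lemma tree_extend (p : pt) (D : seq pt) (P : pt -> seq pt) (E : pred pt) z0 s :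
  tree p D P -> z0 \in D -> path step z0 s ->
  (forall z, z \in D -> z \in z0 :: s -> {subset P z <= E}) -> {subset s <= E} ->
  exists D' P', [/\ tree p D' P', {subset D <= D'}, {subset s <= D'},
    forall z, z \in D' -> z \in D \/ z \in s &
    (forall z, z \in D -> P' z = P z) /\ (forall z, z \in s -> {subset P' z <= E})].
Proof.
elim: s z0 D P => [|y s IH] z0 D P TP zD /=.
  by move=> _ _ _; exists D, P; split=> // z zD'; left.
case/andP=> zy ps DE sE.
have sE' : {subset s <= E} by move=> z zs; apply: sE; rewrite inE zs orbT.
have yE : E y by apply: sE; apply: mem_head.
have [yD|yD] := boolP (y \in D).
  have [|D' [P' [T' DD' sD' D'D [PP' P'E]]]] := IH y D P TP yD ps _ sE'.
    by move=> z zD' zs; apply: DE => //; rewrite inE zs orbT.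
  exists D', P'; split=> //.
  - by move=> z; rewrite inE => /predU1P[->|/sD'//]; apply: DD'.
  - by move=> z /D'D[|zs]; [left|right; rewrite inE zs orbT].
  split=> // z; rewrite inE => /predU1P[->|/P'E//].
  by rewrite PP' //; apply: DE => //; rewrite !inE eqxx orbT.
case: TP => pD TP.
pose P1 z := if z == y then rcons (P z0) y else P z.
have P1D z : z \in D -> P1 z = P z.
  by rewrite /P1; case: eqP => // ->; rewrite (negPf yD).
have P1y : P1 y = rcons (P z0) y by rewrite /P1 eqxx.
have T1 : tree p (y :: D) P1.
  split; first by rewrite inE pD orbT.
  move=> z; rewrite inE => /predU1P[->|zD'].
    have [h1 h2 h3 h4] := TP _ zD; rewrite P1y; split.
    - by rewrite rcons_path h1 h2.
    - by rewrite last_rcons.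
    - rewrite -rcons_cons rcons_uniq h3 andbT; apply/negP => /h4[yD' _].
      by rewrite yD' in yD.
    move=> w; rewrite -rcons_cons mem_rcons inE => /predU1P[->|/h4[wD pw]].
      by rewrite mem_head P1y prefix_refl.
    rewrite inE wD orbT P1D //; split=> //.
    by apply: prefix_trans pw _; apply: prefix_rcons.
  have [h1 h2 h3 h4] := TP _ zD'; rewrite P1D //; split=> // w /h4[wD pw].
  by rewrite inE wD orbT P1D.
have [|D' [P' [T' DD' sD' D'D [PP' P'E]]]] := IH y (y :: D) P1 T1 (mem_head _ _) ps _ sE'.
  move=> z; rewrite inE => /predU1P[-> _|zD' zs].
    rewrite P1y => w; rewrite mem_rcons inE => /predU1P[->//|].
    by apply: (DE z0 zD); apply: mem_head.
  by rewrite P1D //; apply: DE => //; rewrite in_cons; apply/orP; right.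
exists D', P'; split=> //.
- by move=> z zD'; apply: DD'; rewrite inE zD' orbT.
- by move=> z; rewrite inE => /predU1P[->|/sD'//]; apply: DD'; apply: mem_head.
- move=> z /D'D[|zs]; last by right; rewrite inE zs orbT.
  by rewrite inE => /predU1P[->|]; [right; apply: mem_head|left].
split=> [z zD'|z]; first by rewrite PP' ?P1D // inE zD' orbT.
rewrite inE => /predU1P[->|/P'E//].
rewrite PP' ?mem_head // P1y => w; rewrite mem_rcons inE => /predU1P[->//|].
by apply: (DE z0 zD); apply: mem_head.
Qed.

(** A common point [z] of both branches after they have parted would make the
    branch to [z] a common prefix that is too long. *)
Lemma tree_fork (p : pt) (D : seq pt) (P : pt -> seq pt) u x : tree p D P ->
  u \in D -> x \in D -> u \notin p :: P x -> x \notin p :: P u ->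
  fork [:: p] (P u) (P x).
Proof.
move=> [_ TP] uD xD ux xu.
have [_ lu nu fu] := TP _ uD; have [_ lx nx fx] := TP _ xD.
suff H c s t : P u = c ++ s -> P x = c ++ t -> fork (p :: c) s t by apply: (H [::]).
elim: s c t => [|h s IH] c t Eu Ex.
  case/negP: ux; rewrite -lu Eu Ex cats0 -cat_cons mem_cat.
  by rewrite mem_last.
case: t Ex => [|k t] Ex.
  case/negP: xu; rewrite -lx Eu Ex cats0 -cat_cons mem_cat.
  by rewrite mem_last.
rewrite /=; case: eqP => [hk|/eqP hk].
  by rewrite -rcons_cons; apply: IH; rewrite cat_rcons // hk.
have sep (y : seq pt) : uniq (p :: c ++ y) -> avoids (p :: c) y.
  rewrite -cat_cons cat_uniq => /and3P[_ /hasPn ny _] z zc; apply/negP => /ny.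
  by rewrite /= zc.
have dh : avoids (p :: c) (h :: s) by apply: sep; rewrite -Eu.
have dk : avoids (p :: c) (k :: t) by apply: sep; rewrite -Ex.
split=> // z zh; apply/negP => zk.
have [|zD /prefixP[r Er]] := fu z; first by rewrite Eu inE mem_cat zh !orbT.
have [|_ /prefixP[r' Er']] := fx z; first by rewrite Ex inE mem_cat zk !orbT.
have [_ lz _ _] := TP _ zD.
(* The branch to z either ends in the common part or reaches past the fork. *)
have [sz|sz] := leqP (size (P z)) (size c).
  have zc : z \in p :: c.
    have -> : c = P z ++ take (size c - size (P z)) r.
      have : take (size c) (P u) = take (size c) (P u) by [].
      rewrite {1}Eu take_size_cat // Er take_cat ltnNge sz /=; exact.
    by have := mem_last p (P z); rewrite lz -cat_cons mem_cat => ->.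
  by have := dh _ zc; rewrite zh.
have n1 : nth p (P u) (size c) = h by rewrite Eu nth_cat ltnn subnn.
have n2 : nth p (P x) (size c) = k by rewrite Ex nth_cat ltnn subnn.
by case/eqP: hk; rewrite -n1 -n2 Er Er' !nth_cat sz.
Qed.

(** The walks [Y v] may share points and become a tree; the tails [T v] are added
    afterwards. A tail comes close to the edges at its vertex, so the branch to v
    must not run through the tail of another vertex: this is the fourth
    conclusion. *)
Lemma star_tree (V : finType) (p : pt) (q g : V -> pt) (Y T : V -> seq pt) :
  let Z z := (z == p) || [exists v, z \in Y v] in
  (forall v, path step p (Y v)) -> (forall v, last p (Y v) = q v) ->
  (forall v, path step (q v) (T v)) -> (forall v, last (q v) (T v) = g v) ->
  (forall u v, u != v -> avoids (T u) (T v)) ->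
  (forall v, ~~ Z (g v)) ->
  exists st : V -> seq pt,
  [/\ forall v, path step p (st v), forall v, last p (st v) = g v,
      forall v, uniq (p :: st v),
      forall v z, z \in p :: st v -> Z z || (z \in T v) &
      forall u v, u != v -> fork [:: p] (st u) (st v)].
Proof.
move=> Z pY lY pT lT dT gZ.
have qZ v : Z (q v).
  have := mem_last p (Y v); rewrite lY inE /Z => /orP[->//|qs].
  by apply/orP; right; apply/existsP; exists v.
have [D0 [P0 [T0 D0Z ZD0]]] : exists D P,
    [/\ tree p D P, {subset D <= Z} & forall v, {subset Y v <= D}].
  suff [D [P [TP DZ YD]]] : exists D P,
      [/\ tree p D P, {subset D <= Z} & forall v, v \in enum V -> {subset Y v <= D}].
    by exists D, P; split=> // v; apply: YD; rewrite mem_enum.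
  elim: (enum V) => [|v vs [D [P [TP DZ YD]]]].
    exists [:: p], (fun _ => [::]); split=> //; last first.
      by move=> z; rewrite inE => /eqP->; rewrite /in_mem /= /Z eqxx.
    split=> [|z]; first by rewrite mem_head.
    by rewrite inE => /eqP->; split=> // w; rewrite inE => /eqP->; rewrite mem_head.
  have [pD _] := TP.
  have [//|//|D' [P' [T' DD' sD' D'D _]]] := tree_extend (E := predT) TP pD (pY v).
  exists D', P'; split=> //.
    move=> z /D'D[/DZ//|zY]; rewrite /in_mem /= /Z; apply/orP; right.
    by apply/existsP; exists v.
  by move=> u; rewrite inE => /predU1P[->//|/YD uD z /uD /DD'].
have ZD z : Z z -> z \in D0.
  case/orP=> [/eqP->|/existsP[v /ZD0//]]; by case: T0.
have [D [P [TP _ _ gD]]] : exists D P, [/\ tree p D P, {subset D0 <= D},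
    (forall z, z \in D0 -> P z = P0 z) /\
      (forall z, z \in D -> Z z \/ exists2 v, v \in enum V & z \in T v) &
    forall v, v \in enum V ->
      g v \in D /\ {subset P (g v) <= [pred z | Z z || (z \in T v)]}].
  elim: (enum V) (enum_uniq V) => [|v vs IH] /=.
    by move=> _; exists D0, P0; split=> //; split=> // z /D0Z; left.
  case/andP=> vvs /IH[D [P [TP DD0 [P0P DT] gD]]].
  have P0Z z : Z z -> {subset P z <= Z}.
    move=> /ZD zD; rewrite P0P //; case: T0 => _ /(_ _ zD)[_ _ _ h] w wP.
    by apply: D0Z; apply: (h w _).1; rewrite inE wP orbT.
  have [||D' [P' [T' DD' sD' D'D [PP' P'E]]]] :=
      tree_extend (E := [pred z | Z z || (z \in T v)]) TP (DD0 _ (ZD _ (qZ v))) (pT v).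
  - move=> z zD zq w wP; apply/orP; left.
    suff Zz : Z z by exact: P0Z wP.
    move: zq; rewrite inE => /predU1P[->//|zT].
    case: (DT _ zD) => // -[u uvs zu]; exfalso.
    have uv : u != v by apply: contraNneq vvs => <-.
    by have := dT _ _ uv _ zu; rewrite zT.
  - by move=> z zT; rewrite inE /= zT orbT.
  exists D', P'; split=> //.
  - by move=> z /DD0 /DD'.
  - split=> [z zD|z /D'D[/DT[|[u uvs zu]]|zT]]; first by rewrite PP' ?P0P //; apply: DD0.
    + by left.
    + by right; exists u; rewrite // inE uvs orbT.
    by right; exists v; rewrite // mem_head.
  move=> u; rewrite inE => /predU1P[->|/gD[uD uP]]; last by split; [apply: DD'|rewrite PP'].
  have gT : g v \in T v.
    move: (mem_last (q v) (T v)); rewrite lT inE => /predU1P[E|//].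
    by have := gZ v; rewrite E qZ.
  by split; [apply: sD'|apply: P'E].
have gDv v : g v \in D by apply: (gD v _).1; rewrite mem_enum.
have [_ TP2] := TP.
have PE v z : z \in p :: P (g v) -> Z z || (z \in T v).
  rewrite inE => /predU1P[->|]; first by rewrite /Z eqxx.
  by apply: (gD v _).2; rewrite mem_enum.
have nf u v : u != v -> g u \notin p :: P (g v).
  move=> uv; apply/negP => /PE; rewrite (negPf (gZ u)) /= => guT.
  have gT : g u \in T u.
    move: (mem_last (q u) (T u)); rewrite lT inE => /predU1P[E|//].
    by have := gZ u; rewrite E qZ.
  by have := dT _ _ uv _ gT; rewrite guT.
exists (fun v => P (g v)); split=> [v|v|v|//|u v uv]; first by case: (TP2 _ (gDv v)).
- by case: (TP2 _ (gDv v)).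
- by case: (TP2 _ (gDv v)).
by apply: (tree_fork TP) => //; apply: nf; rewrite // eq_sym.
Qed.

End GridWalks.

(** * From plane drawings to grid walks *)

Section PlaneDrawings.
Import Order.TTheory GRing.Theory Num.Theory.
Import numFieldNormedType.Exports.
Local Open Scope classical_set_scope.
Local Open Scope ring_scope.

(** The points of [A] related to [x] form a set that is open and closed in [A]. *)
Lemma connected_locally (T : topologicalType) (A : set T) (Q : T -> T -> Prop) :
  connected A ->
  (forall x y z, A y -> Q x y -> Q y z -> Q x z) ->
  (forall x, A x -> \forall y \near x, A y -> Q x y /\ Q y x) ->
  forall x y, A x -> A y -> Q x y.
Proof.
move=> cA trQ locQ x y Ax Ay.
have Qxx : Q x x by have /nbhs_singleton/(_ Ax)[] := locQ _ Ax.
suff E : A `&` Q x = A by move: Ay; rewrite -E => -[].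
apply: cA; first by exists x.
- exists (\bigcup_(U in [set U | open U /\ A `&` U `<=` Q x]) U).
    by apply: bigcup_open => U [].
  apply/seteqP; split=> z [Az]; last by move=> [U [_ UQ] Uz]; split=> //; apply: UQ.
  move=> Qz; split=> //; have : nbhs z (fun w => A w -> Q z w /\ Q w z) := locQ _ Az.
  rewrite nbhsE => -[U [oU Uz] UP].
  exists U => //; split=> // w [Aw Uw].
  by apply: (trQ _ _ _ Az Qz); case: (UP _ Uw Aw).
exists (closure (A `&` Q x)); first exact: closed_closure.
apply/seteqP; split=> z [Az]; first by move=> Qz; split=> //; apply: subset_closure.
move=> /(_ _ (locQ _ Az))[w [[Aw Qw] /(_ Aw)[_ Qwz]]]; split=> //.
exact: trQ Aw Qw Qwz.
Qed.

(** Each point of [A] has a ball that misses [B]; half its radius serves all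
    points near it, and compactness makes the radius uniform. *)
Lemma compact_closed_apart (R : realType) (T : pseudoMetricType R) (A B : set T) :
  compact A -> closed B -> A `&` B = set0 ->
  \forall e \near (0 : R)^'+, forall a b, A a -> B b -> ~ ball a e b.
Proof.
move=> cA clB AB.
have /compact_near_coveringP/(_ _ (0 : R)^'+ (fun e a => forall b, B b -> ~ ball a e b)) := cA.
move=> /(_ _) H; apply: filterS (H _) => [e He a b Aa|x Ax].
  exact: He.
have Bx : (~` B) x by move=> Bx; have : (A `&` B) x by []; rewrite AB.
have : nbhs x (~` B) by apply: open_nbhs_nbhs; split=> //; apply: closed_openC.
case/nbhs_ballP => d /= d0 dB.
exists (ball x (d / 2), [set e | e < d / 2]).
  split; first by apply: nbhsx_ballx; rewrite divr_gt0.
  by apply: nbhs_right_lt; rewrite divr_gt0.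
move=> [x' e] [/= xx' ed] b Bb x'b; apply: (dB b) => //.
rewrite [d]splitr; apply: ball_triangle xx' _.
by apply: le_ball x'b; apply: ltW.
Qed.

Lemma near_inv_lt (R : realType) (e : R) : 0 < e ->
  \forall N \near \oo, (0 < N)%N /\ 2 / N%:R < e.
Proof.
move=> e0; exists (Num.bound (2 / e)).+1 => // N /= hN.
have N0 : (0 < N)%N by apply: leq_trans hN.
have N0' : 0 < N%:R :> R by rewrite ltr0n.
split=> //; rewrite ltr_pdivrMr // mulrC -ltr_pdivrMr //.
apply: lt_le_trans (archi_boundP _) _; first by rewrite divr_ge0 // ltW.
by rewrite ler_nat ltnW.
Qed.

Definition walk_in (W : pt -> Prop) (a b : pt) : Prop :=
  exists s, [/\ path step a s, last a s = b & forall z, z \in a :: s -> W z].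

Lemma walk_in_trans (W : pt -> Prop) a b c :
  walk_in W a b -> walk_in W b c -> walk_in W a c.
Proof.
move=> [s [ps ls Ws]] [t [qt lt Wt]]; exists (s ++ t); split.
- by rewrite cat_path ps ls.
- by rewrite last_cat ls.
move=> z; rewrite -cat_cons mem_cat => /orP[/Ws//|zt].
by apply: Wt; rewrite inE zt orbT.
Qed.

Lemma walk_in_sub (W W' : pt -> Prop) a b :
  (forall z, W z -> W' z) -> walk_in W a b -> walk_in W' a b.
Proof. by move=> WW [s [ps ls Ws]]; exists s; split=> // z /Ws /WW. Qed.

Lemma int_toward (a b : int) : a != b ->
  exists c : int, ((c == a + 1) || (a == c + 1)) && (`|b - c| + 1 == `|b - a|).
Proof.
case: (ltgtP a b) => // ab _; first by exists (a + 1); lia.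
by exists (a - 1); lia.
Qed.

(** Walk along the first coordinate and then along the second: the walk stays in
    the box spanned by its ends. *)
Lemma walk_box (a b : pt) : walk_in (fun z =>
  `|z.1 - a.1| <= `|b.1 - a.1| /\ `|z.2 - a.2| <= `|b.2 - a.2|) a b.
Proof.
have [n le_n] := ubnP (absz (b.1 - a.1) + absz (b.2 - a.2)).
elim: n a le_n => // n IH [a1 a2]; case: b IH => b1 b2 /= IH le_n.
have [E1|n1] := eqVneq a1 b1.
  have [E2|n2] := eqVneq a2 b2.
    exists [::]; split=> //=; first by rewrite E1 E2.
    by move=> z; rewrite inE => /eqP-> /=; rewrite !subrr normr0 !normr_ge0.
  have [c cE] := int_toward n2.
  have [|s [ps ls Ws]] := IH (a1, c); first by move: cE le_n => /=; lia.
  exists ((a1, c) :: s); split=> //=; first by rewrite ps andbT /step /=; move: cE; lia.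
  move=> z; rewrite inE => /predU1P[->|/Ws] /=; move: cE; lia.
have [c cE] := int_toward n1.
have [|s [ps ls Ws]] := IH (c, a2); first by move: cE le_n => /=; lia.
exists ((c, a2) :: s); split=> //=; first by rewrite ps andbT /step /=; move: cE; lia.
move=> z; rewrite inE => /predU1P[->|/Ws] /=; move: cE; lia.
Qed.

Section Rounding.
Variable R : realType.
Implicit Types (x y : R * R) (N : nat).

Definition grid_round N x : pt := (Num.floor (N%:R * x.1), Num.floor (N%:R * x.2)).
Definition grid_pos N (z : pt) : R * R := (z.1%:~R / N%:R, z.2%:~R / N%:R).

(** The error consists of one unit of rounding at each end, on a grid of mesh
    [1 / N]. *)
Lemma round_coord N (s t d : R) (z : int) : (0 < N)%N -> `|s - t| < d ->
  `|z - Num.floor (N%:R * s)| <= `|Num.floor (N%:R * t) - Num.floor (N%:R * s)| ->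
  `|s - z%:~R / N%:R| < d + 2 / N%:R.
Proof.
move=> N0 st; have N0' : 0 < N%:R :> R by rewrite ltr0n.
have Ni0 : 0 < (N%:R)^-1 :> R by rewrite invr_gt0.
have := floor_itv (N%:R * s); have := floor_itv (N%:R * t).
move: (Num.floor _) (Num.floor _) => a b; rewrite !intrD !mulr1z => /andP[b1 b2] /andP[a1 a2] zab.
have {}zab : `|z%:~R - a%:~R| <= `|b%:~R - a%:~R| :> R by rewrite -!intrB -!intr_norm ler_int.
have ab : `|b%:~R - a%:~R| < N%:R * d + 1 :> R.
  have : `|N%:R * s - N%:R * t| < N%:R * d by rewrite -mulrBr normrM gtr0_norm // ltr_pM2l.
  by rewrite !ltr_norml => /andP[h1 h2]; apply/andP; split; lra.
have zs : `|N%:R * s - z%:~R| < N%:R * d + 2.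
  have := le_lt_trans zab ab; rewrite !ltr_norml => /andP[z1 z2]; apply/andP; split; lra.
have -> : s - z%:~R / N%:R = (N%:R * s - z%:~R) / N%:R.
  by rewrite mulrBl mulrAC mulfV ?mul1r // gt_eqF.
rewrite normrM [X in _ * X]gtr0_norm // ltr_pdivrMr // mulrDl divfK ?gt_eqF //.
by rewrite [d * _]mulrC.
Qed.
End Rounding.

Definition clear_of (R : realType) (S : set (R * R)) N (r : R) (z : pt) : Prop :=
  forall P, S P -> ~ ball (grid_pos R N z) r P.

Definition close_to (R : realType) (E : set (R * R)) N (e : R) (z : pt) : Prop :=
  exists2 P, E P & ball P e (grid_pos R N z).

Section Drawing.
Variables (R : realType) (G : sgraph) (pos : G -> R * R) (arc : G -> G -> R -> R * R).
Hypothesis drawing : plane_drawing pos arc.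

Definition edge (u v : G) : set (R * R) := arc u v @` [set` `[0, 1]].

Lemma ball_sub_tri (x y z : R * R) (d d' e : R) : d + d' <= e ->
  ball x d y -> ball y d' z -> ball x e z.
Proof. by move=> de xy yz; apply: le_ball de _ _; apply: ball_triangle yz. Qed.

Lemma walk_ball N (x y : R * R) (d : R) : (0 < N)%N -> ball x d y ->
  walk_in (fun z => ball x (d + 2 / N%:R) (grid_pos R N z)) (grid_round N x) (grid_round N y).
Proof.
move=> N0 [d1 d2]; apply: walk_in_sub (walk_box _ _) => z [z1 z2].
by split; [exact: round_coord N0 d1 z1|exact: round_coord N0 d2 z2].
Qed.

Lemma edge_compact u v : adj u v -> compact (edge u v).
Proof.
move=> uv; rewrite /edge; apply: continuous_compact; last exact: segment_compact.
exact: (arc_continuous drawing uv).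
Qed.

Lemma edge_connected u v : adj u v -> connected (edge u v).
Proof.
move=> uv; rewrite /edge; apply: connected_continuous_connected.
  exact: segment_connected.
exact: (arc_continuous drawing uv).
Qed.

Lemma edge_source u v : adj u v -> edge u v (pos u).
Proof. by move=> uv; exists 0; rewrite ?(arc_source drawing uv) //= in_itv /= lexx ler01. Qed.

Lemma edge_target u v : adj u v -> edge u v (pos v).
Proof. by move=> uv; exists 1; rewrite ?(arc_target drawing uv) //= in_itv /= lexx ler01. Qed.

Lemma edge_inv u v P : adj u v -> edge u v P ->
  [\/ P = pos u, P = pos v | exists2 t, 0 < t < 1 & P = arc u v t].
Proof.
move=> uv [t]; rewrite /= in_itv /= => /andP[t0 t1] <-.
have [->|n0] := eqVneq t 0; first by constructor 1; rewrite (arc_source drawing).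
have [->|n1] := eqVneq t 1; first by constructor 2; rewrite (arc_target drawing).
by constructor 3; exists t; rewrite // !lt_neqAle t0 t1 n1 eq_sym n0.
Qed.

Lemma vertex_notin_edge u v w : adj u v -> w \notin [:: u; v] -> ~ edge u v (pos w).
Proof.
move=> uv; rewrite !inE negb_or => /andP[/eqP wu /eqP wv].
move=> /(edge_inv uv)[|/(pos_inj drawing)//|[t t01]].
  by move/(pos_inj drawing).
by move/esym; apply: (arc_avoids_vertices drawing uv t01).
Qed.

(** The drawing separates open arcs from open arcs, open arcs from vertices and
    vertices from each other; together these separate the closed arcs. *)
Lemma edges_disjoint u v x y : adj u v -> adj x y -> uniq [:: u; v; x; y] ->
  edge u v `&` edge x y = set0.
Proof.
move=> uv xy; rewrite /= !inE !negb_or => /and4P[/and3P[_ ux uy] /andP[vx vy] _ _].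
have off w : w \in [:: x; y] -> w \notin [:: u; v].
  by rewrite !inE negb_or => /orP[]/eqP->; rewrite ![_ == u]eq_sym ![_ == v]eq_sym ?ux ?uy ?vx ?vy.
have off' w : w \in [:: u; v] -> w \notin [:: x; y].
  by rewrite !inE negb_or => /orP[]/eqP->; rewrite ?ux ?uy ?vx ?vy.
apply/seteqP; split=> // P [Euv Exy].
case: (edge_inv xy Exy) => [E|E|[t t01 Et]].
- by apply: (vertex_notin_edge uv (off x _)); rewrite ?mem_head // -E.
- by apply: (vertex_notin_edge uv (off y _)); rewrite ?inE ?eqxx ?orbT // -E.
case: (edge_inv uv Euv) => [E|E|[s s01 Es]].
- by apply: (vertex_notin_edge xy (off' u _)); rewrite ?mem_head // -E.
- by apply: (vertex_notin_edge xy (off' v _)); rewrite ?inE ?eqxx ?orbT // -E.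
apply: (arc_disjoint drawing uv xy _ s01 t01); last by rewrite -Es Et.
move=> E; have : u \in [set x; y]%SET by rewrite -E !inE eqxx.
by rewrite !inE (negPf ux) (negPf uy).
Qed.

Lemma R2_hausdorff : hausdorff_space (R * R)%type.
Proof. exact: norm_hausdorff. Qed.

Lemma edge_support u v : adj u v -> edge u v `<=` drawing_support pos arc.
Proof. by move=> uv P [t]; rewrite /= in_itv /= => t01 <-; right; exists u, v, t. Qed.

Lemma support_closed : closed (drawing_support pos arc).
Proof.
apply: closedU.
  have -> : range pos = \bigcup_(v in [set: G]) [set pos v].
    by apply/seteqP; split=> P [v _]; [move=> <-; exists v|move=> ->; exists v].
  apply: closed_bigcup; first exact: finite_finset.
  by move=> v _; apply: compact_closed; [exact: R2_hausdorff|exact: compact_set1].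
have -> : [set P | exists u v t, [/\ adj u v, 0 <= t <= 1 & P = arc u v t]] =
    \bigcup_(e in [set e : G * G | adj e.1 e.2]) edge e.1 e.2.
  apply/seteqP; split=> P; first by move=> [u [v [t [uv t01 ->]]]]; exists (u, v) => //; exists t.
  by move=> [[u v] /= uv [t]]; rewrite /= in_itv /= => t01 <-; exists u, v, t.
apply: closed_bigcup; first exact: finite_finset.
by move=> [u v] /= uv; apply: compact_closed; [exact: R2_hausdorff|exact: edge_compact].
Qed.

Lemma near_edges_apart : \forall e \near (0 : R)^'+, forall u v x y, adj u v -> adj x y ->
  uniq [:: u; v; x; y] -> forall P Q, edge u v P -> edge x y Q -> ~ ball P e Q.
Proof.
apply: filter_forall => u; apply: filter_forall => v.
apply: filter_forall => x; apply: filter_forall => y.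
have [uv|/negPf uv] := boolP (adj u v); last by apply: nearW => e.
have [xy|/negPf xy] := boolP (adj x y); last by apply: nearW => e.
have [un|/negPf un] := boolP (uniq [:: u; v; x; y]); last by apply: nearW => e.
have cl : closed (edge x y) by apply: compact_closed; [exact: R2_hausdorff|exact: edge_compact].
have := compact_closed_apart (edge_compact uv) cl (edges_disjoint uv xy un).
by apply: filterS => e H _ _ _.
Qed.

Lemma near_vertex_edge_apart : \forall e \near (0 : R)^'+, forall u v w, adj u v ->
  w \notin [:: u; v] -> forall P, edge u v P -> ~ ball (pos w) e P.
Proof.
apply: filter_forall => u; apply: filter_forall => v; apply: filter_forall => w.
have [uv|/negPf uv] := boolP (adj u v); last by apply: nearW => e.
have [nw|/negPf nw] := boolP (w \notin [:: u; v]); last by apply: nearW => e.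
have cl : closed (edge u v) by apply: compact_closed; [exact: R2_hausdorff|exact: edge_compact].
have dis : [set pos w] `&` edge u v = set0.
  by apply/seteqP; split=> // P [/= ->]; apply: vertex_notin_edge.
have := compact_closed_apart (@compact_set1 _ (pos w)) cl dis.
by apply: filterS => e H _ _ P EP; apply: H.
Qed.

Lemma near_vertices_apart : \forall e \near (0 : R)^'+, forall u v, u != v ->
  ~ ball (pos u) e (pos v).
Proof.
apply: filter_forall => u; apply: filter_forall => v.
have [->|uv] := eqVneq u v; first by apply: nearW.
have cl : closed [set pos v] by apply: compact_closed; [exact: R2_hausdorff|exact: compact_set1].
have dis : [set pos u] `&` [set pos v] = set0.
  apply/seteqP; split=> // P [/= ->] /(pos_inj drawing) E.
  by rewrite E eqxx in uv.
have := compact_closed_apart (@compact_set1 _ (pos u)) cl dis.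
by apply: filterS => e H _; apply: H.
Qed.

(** The property is transitive in the ends of the walk and holds for nearby ends,
    since the support is closed. *)
Lemma walk_in_face (F : set (R * R)) : connected F -> F `<=` ~` drawing_support pos arc ->
  forall x y, F x -> F y -> \forall r \near (0 : R)^'+, \forall N \near \oo,
    walk_in (clear_of (drawing_support pos arc) N r)
      (grid_round N x) (grid_round N y).
Proof.
move=> cF FS; apply: (connected_locally cF).
  move=> x y z _; apply: filterS2 => r; apply: filterS2 => N.
  exact: walk_in_trans.
move=> x Fx.
have : nbhs x (~` drawing_support pos arc).
  apply: open_nbhs_nbhs; split; last exact: FS.
  by apply: closed_openC; exact: support_closed.
case/nbhs_ballP => d /= d0 dS.
have d8 : 0 < d / 8 by rewrite divr_gt0.
have L (y z : R * R) : ball x (d / 8) y -> ball x (d / 8) z ->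
    \forall r \near (0 : R)^'+, \forall N \near \oo,
    walk_in (clear_of (drawing_support pos arc) N r)
      (grid_round N y) (grid_round N z).
  move=> xy xz.
  have yz : ball y (d / 4) z.
    by apply: (@ball_sub_tri _ x _ (d / 8) (d / 8)) => //; [lra|exact: ball_sym].
  near=> r.
  have rd8 : r < d / 8 by near: r; exact: nbhs_right_lt.
  have := near_inv_lt d8; apply: filterS => N [N0 Nd].
  apply: walk_in_sub (walk_ball N0 yz) => w yw P SP wP.
  apply: (dS P) SP.
  apply: (ball_sub_tri _ (ball_sub_tri (lexx _) xy yw) wP); lra.
near=> y => _; split; apply: L.
- exact: ballxx.
- by near: y; apply: nbhsx_ballx.
- by near: y; apply: nbhsx_ballx.
- exact: ballxx.
Unshelve. all: by end_near. Qed.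

(** Continuity of the arc enters only through the connectedness of its image. *)
Lemma walk_along_edge (u v : G) (e : R) : adj u v -> 0 < e ->
  \forall N \near \oo,
    walk_in (close_to (edge u v) N e) (grid_round N (pos u)) (grid_round N (pos v)).
Proof.
move=> uv e0; move: (edge_source uv) (edge_target uv).
move: (pos u) (pos v); apply: (connected_locally (edge_connected uv)).
  by move=> x y z _; apply: filterS2 => N; apply: walk_in_trans.
move=> x Ex.
have e2 : 0 < e / 2 by rewrite divr_gt0.
have L (y z : R * R) : edge u v y -> ball y (e / 2) z -> \forall N \near \oo,
    walk_in (close_to (edge u v) N e) (grid_round N y) (grid_round N z).
  move=> Ey yz; have := near_inv_lt e2; apply: filterS => N [N0 Ne].
  apply: walk_in_sub (walk_ball N0 yz) => w yw; exists y => //.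
  apply: le_ball yw; lra.
near=> y => Ey.
have xy : ball x (e / 2) y by near: y; apply: nbhsx_ballx.
by split; apply: L => //; apply: ball_sym.
Unshelve. all: by end_near. Qed.
End Drawing.

(** * Outerplanar graphs have noncrossing vertex orders *)

(** The constants are chosen in this order: [e] bounds from below the distances
    between disjoint edges, between vertices and edges away from them, and
    between vertices; [q v] is a point of the face at distance less than [e / 8]
    from v; [r] bounds the distance from the walks in the face to the drawing;
    [e'] is how closely the grid walks follow the edges; [N] makes the grid fine
    compared with all of these. *)
Lemma outerplanar_noncrossing (R : realType) (G : sgraph) : outerplanar R G ->
  exists l : seq G, [/\ uniq l, forall v, v \in l & noncrossing adj l].
Proof.
case=> pos [arc [dr [F [[p0 Sp0 FE] _] clF]]].
have FS : F `<=` ~` drawing_support pos arc by rewrite FE; apply: connected_component_sub.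
have cF : connected F by rewrite FE; apply: component_connected.
have Fp0 : F p0 by rewrite FE; apply: connected_component_refl.
have : \forall e \near (0 : R)^'+, [/\ 0 < e,
    forall u v x y, adj u v -> adj x y -> uniq [:: u; v; x; y] ->
      forall P Q, edge arc u v P -> edge arc x y Q -> ~ ball P e Q,
    forall u v w, adj u v -> w \notin [:: u; v] ->
      forall P, edge arc u v P -> ~ ball (pos w) e P &
    forall u v, u != v -> ~ ball (pos u) e (pos v)].
  near=> e; split; near: e; [exact: nbhs_right_gt|exact: (near_edges_apart dr)|
    exact: (near_vertex_edge_apart dr)|exact: (near_vertices_apart dr)].
case/filter_ex => e [e0 ee ve vv].
have e8 : 0 < e / 8 by rewrite divr_gt0.
have qE v : exists P, F P /\ ball (pos v) (e / 8) P.
  by have [P [FP vP]] := clF v _ (nbhsx_ballx (pos v) _ e8); exists P.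
have [q qP] := choice qE.
have : \forall r \near (0 : R)^'+, 0 < r /\ forall v, \forall N \near \oo,
    walk_in (clear_of (drawing_support pos arc) N r)
      (grid_round N p0) (grid_round N (q v)).
  near=> r; split; near: r; first exact: nbhs_right_gt.
  by apply: filter_forall => v; apply: (walk_in_face dr cF FS Fp0); case: (qP v).
case/filter_ex => r [r0 wF].
pose e' := Num.min e r / 4.
have m0 : 0 < Num.min e r by rewrite lt_min e0.
have e'0 : 0 < e' by rewrite divr_gt0.
have e'e : e' <= e / 4 by rewrite /e' ler_pM2r ?invr_gt0 // ge_min lexx.
have e'r : e' <= r / 4 by rewrite /e' ler_pM2r ?invr_gt0 // ge_min lexx orbT.
have r2 : 0 < r / 2 by rewrite divr_gt0.
have : \forall N \near \oo, [/\ (0 < N)%N /\ 2 / N%:R < e / 8,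
    (0 < N)%N /\ 2 / N%:R < r / 2,
    forall v, walk_in (clear_of (drawing_support pos arc) N r)
      (grid_round N p0) (grid_round N (q v)) &
    forall u v, adj u v ->
      walk_in (close_to (edge arc u v) N e')
        (grid_round N (pos u)) (grid_round N (pos v))].
  near=> N; split; near: N; [exact: near_inv_lt|exact: near_inv_lt|exact: filter_forall|].
  apply: filter_forall => u; apply: filter_forall => v.
  case: (boolP (adj u v)) => uv; last by apply: nearW.
  by apply: filterS (walk_along_edge dr uv e'0).
case/filter_ex => N [[N0 Ne] [_ Nr] wY wW].
have [Y YP] := choice wY.
have [W WP] : exists W : G -> G -> seq pt, forall u v, adj u v ->
    [/\ path step (grid_round N (pos u)) (W u v),
      last (grid_round N (pos u)) (W u v) = grid_round N (pos v) &
      forall z, z \in grid_round N (pos u) :: W u v -> close_to (edge arc u v) N e' z].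
  have WE (d : G * G) : exists s : seq pt, adj d.1 d.2 ->
      [/\ path step (grid_round N (pos d.1)) s,
        last (grid_round N (pos d.1)) s = grid_round N (pos d.2) &
        forall z, z \in grid_round N (pos d.1) :: s -> close_to (edge arc d.1 d.2) N e' z].
    case: d => u v /=; case: (boolP (adj u v)) => uv; last by exists [::].
    by have [s sP] := wW u v uv; exists s.
  have [W0 WP0] := choice WE.
  by exists (fun u v => W0 (u, v)) => u v uv; apply: (WP0 (u, v) uv).
have wT v : walk_in (fun z => ball (pos v) (e / 2) (grid_pos R N z))
    (grid_round N (q v)) (grid_round N (pos v)).
  have [_ vq] := qP v.
  apply: walk_in_sub (walk_ball N0 (ball_sym vq)) => z qz.
  apply: ball_sub_tri vq qz; lra.
have [T TP] := choice wT.
have YS v z : z \in grid_round N p0 :: Y v -> clear_of (drawing_support pos arc) N r z.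
  by case: (YP v) => _ _; apply.
have gfar v : ball (grid_pos R N (grid_round N (pos v))) r (pos v).
  have [s [_ _ /(_ _ (mem_head _ _)) h]] := walk_ball N0 (ballxx (pos v) r2).
  by apply: ball_sym; apply: le_ball h; lra.
have Sv v : drawing_support pos arc (pos v) by left; exists v.
have Tnear v z : z \in T v -> ball (pos v) (e / 2) (grid_pos R N z).
  by move=> zT; case: (TP v) => _ _; apply; rewrite inE zT orbT.
have [||||||st [pst lst ust stZ fst]] := @star_tree G (grid_round N p0)
    (fun v => grid_round N (q v)) (fun v => grid_round N (pos v)) Y T.
- by move=> v; case: (YP v).
- by move=> v; case: (YP v).
- by move=> v; case: (TP v).
- by move=> v; case: (TP v).
(* Tails of distinct vertices are near distinct vertices. *)
- move=> u v uv z zu; apply/negP => zv; apply: (vv _ _ uv).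
  by apply: (ball_sub_tri _ (Tnear _ _ zu) (ball_sym (Tnear _ _ zv))); lra.
- move=> v; apply/negP => /orP[/eqP E|/existsP[u gY]].
    by apply: (YS v (grid_round N (pos v))) (Sv v) (gfar v); rewrite E mem_head.
  by apply: (YS u (grid_round N (pos v))) (Sv v) (gfar v); rewrite inE gY orbT.
(* What remains is that disjoint parts of the drawing have disjoint walks. *)
apply: (@noncrossing_of_star G adj (grid_round N p0) st W) => //.
- by move=> u v uv; rewrite lst; case: (WP u v uv).
- by move=> u v uv; rewrite !lst; case: (WP u v uv).
- move=> u v x y uv xy un z; rewrite !lst => zu; apply/negP => zx.
  have [_ _ /(_ _ zu)[P EP Pz]] := WP u v uv; have [_ _ /(_ _ zx)[Q EQ Qz]] := WP x y xy.
  apply: (ee _ _ _ _ uv xy un _ _ EP EQ).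
  by apply: (ball_sub_tri _ Pz (ball_sym Qz)); lra.
move=> u v x uv xuv z /stZ zx; apply/negP; rewrite lst => zu.
have [_ _ /(_ _ zu)[P EP Pz]] := WP u v uv.
case/orP: zx => [zZ|zT].
  have [w zY] : exists w, z \in grid_round N p0 :: Y w.
    case/orP: zZ => [/eqP->|/existsP[w zw]]; first by exists u; apply: mem_head.
    by exists w; rewrite inE zw orbT.
  apply: (YS w z zY P); first exact: (edge_support _ uv EP).
  by apply: ball_sym; apply: le_ball Pz; lra.
apply: (ve _ _ _ uv xuv P EP).
by apply: (ball_sub_tri _ (Tnear _ _ zT) (ball_sym Pz)); lra.
Unshelve. all: by end_near. Qed.

End PlaneDrawings.

(** * Knowledge of the cops and strategies *)

Section Knowledge.
Variable G : sgraph.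
Implicit Types (a b u v r : G) (K : G -> Prop).

Definition hidden a b r : bool :=
  (1 <= gdist r a <= 2)%N && (1 <= gdist r b <= 2)%N.

Definition sight a b r : option G := if hidden a b r then None else Some r.

(** Positions the robber can reach by his next move without being caught, when the
    cops have just moved to [a] and [b]. *)
Definition after K a b r' : Prop :=
  exists r, [/\ K r, r \notin [:: a; b], stay_or_move r r' & r' \notin [:: a; b]].

(** The cops are to move from [a] and [b] and know that the robber is in [K].
    Only the views that follow a move of the robber are used: they refine [K]. *)
Inductive win : G -> G -> (G -> Prop) -> Prop :=
| WinEmpty a b K : (forall r, ~ K r) -> win a b K
| WinMove a b K a' b' : stay_or_move a a' -> stay_or_move b b' ->
    (forall o, win a' b' (fun r => after K a' b' r /\ sight a' b' r = o)) ->
    win a b K.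

(** The choices hidden in a proof of [win], made into a tree of moves that
    branches on what the cops see. *)
Inductive plan := Halt | Move of G & G & (option G -> plan).

Fixpoint works (p : plan) a b K : Prop :=
  match p with
  | Halt => forall r, ~ K r
  | Move a' b' f => [/\ stay_or_move a a', stay_or_move b b' &
      forall o, works (f o) a' b' (fun r => after K a' b' r /\ sight a' b' r = o)]
  end.

Lemma plan_of_win a b K : win a b K -> exists p, works p a b K.
Proof.
elim=> {a b K} [a b K nK|a b K a' b' sa sb _ IH]; first by exists Halt.
have [f fP] := choice IH.
by exists (Move a' b' f).
Qed.

Definition pair_cops a b : cops G 2 := [ffun i => if i == ord0 then a else b].

Definition follow1 (p : plan) (o : option G) : plan :=
  if p is Move _ _ f then f o else Halt.

(** A history of [2 * t + 1] views, latest first, has one view after each move of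
    the robber and one after each move of the cops, besides the initial view.
    The first kind is kept, earliest first. *)
Fixpoint round_sights (h : seq (view G 2)) : seq (option G) :=
  if h is v :: _ :: h' then rcons (round_sights h') v.2 else [::].

(** The test of legality matters for histories that cannot occur, on which a
    strategy must be legal as well. *)
Definition plan_next (p : plan) (C0 : cops G 2) (h : seq (view G 2)) : cops G 2 :=
  if h is w :: _ then
    if foldl follow1 p (round_sights h) is Move a b _ then
      if [forall i, stay_or_move (w.1 i) (pair_cops a b i)] then pair_cops a b
      else w.1
    else w.1
  else C0.

Lemma plan_next_legal p C0 (w : view G 2) h i :
  stay_or_move (w.1 i) (plan_next p C0 (w :: h) i).
Proof.
rewrite /plan_next; case: foldl => [|a b f]; first by rewrite /stay_or_move eqxx.
by case: ifP => [/forallP->//|_]; rewrite /stay_or_move eqxx.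
Qed.

Definition plan_strategy p C0 : strategy G 2 :=
  @Strategy G 2 C0 (plan_next p C0) (plan_next_legal p C0).

Lemma view_of_pair a b r : view_of 2 (pair_cops a b) r = (pair_cops a b, sight a b r).
Proof.
rewrite /view_of /sight; congr (_, if _ then _ else _).
apply/forallP/andP => [h|[h1 h2] i].
  by split; [have := h ord0|have := h (lift ord0 ord0)]; rewrite ffunE.
by rewrite ffunE; case: ifP.
Qed.

(** The robber stays in the set that the plan is meant for until he is caught, and
    this set is empty when the plan has come to an end. *)
Lemma works_captured p0 C0 (r : nat -> G) : robber_play r ->
  forall p t a b K h,
  run 2 (plan_strategy p0 C0) r t = (pair_cops a b, view_of 2 (pair_cops a b) (r t) :: h) ->
  foldl follow1 p0 (round_sights (run 2 (plan_strategy p0 C0) r t).2) = p ->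
  works p a b K -> K (r t) -> captured 2 (plan_strategy p0 C0) r.
Proof.
move=> play; elim=> [|a' b' f IH] t a b K h rt fp /=; first by move=> nK /nK.
case=> sa sb wk Kr.
have nx : Defs.next (plan_strategy p0 C0) (run 2 (plan_strategy p0 C0) r t).2 = pair_cops a' b'.
  rewrite /= /plan_next; move: fp; rewrite rt /= => ->.
  case: ifP => // /forallP[] i; rewrite !ffunE.
  by case: ifP.
have cap i : pair_cops a' b' i = r t -> captured 2 (plan_strategy p0 C0) r.
  by move=> E; exists t, i; right; rewrite -E -nx.
have cap' i : pair_cops a' b' i = r t.+1 -> captured 2 (plan_strategy p0 C0) r.
  by move=> E; exists t.+1, i; left; rewrite -E -nx.
have [E|ra] := eqVneq a' (r t); first by apply: (cap ord0); rewrite ffunE.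
have [E|rb] := eqVneq b' (r t); first by apply: (cap (lift ord0 ord0)); rewrite ffunE.
have [E|ra'] := eqVneq a' (r t.+1); first by apply: (cap' ord0); rewrite ffunE.
have [E|rb'] := eqVneq b' (r t.+1); first by apply: (cap' (lift ord0 ord0)); rewrite ffunE.
have rt1 : run 2 (plan_strategy p0 C0) r t.+1 =
    (pair_cops a' b', view_of 2 (pair_cops a' b') (r t.+1) ::
    view_of 2 (pair_cops a' b') (r t) :: (run 2 (plan_strategy p0 C0) r t).2).
  by rewrite -nx.
apply: (IH _ t.+1 a' b' _ _ rt1 _ (wk (sight a' b' (r t.+1)))).
  rewrite rt1 -[round_sights _]/(rcons (round_sights _) (view_of 2 (pair_cops a' b') (r t.+1)).2).
  by rewrite foldl_rcons fp view_of_pair.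
split=> //; exists (r t); split=> //.
- by rewrite !inE negb_or ![r t == _]eq_sym ra rb.
- by rewrite !inE negb_or ![r t.+1 == _]eq_sym ra' rb'.
Qed.

Lemma cops_win_of_win a b : win a b (fun r => r \notin [:: a; b]) -> cops_win G 2 2.
Proof.
case/plan_of_win=> p wp; exists (plan_strategy p (pair_cops a b)) => r play.
have [E|ra] := eqVneq a (r 0%N).
  by exists 0%N, ord0; left; rewrite /= ffunE.
have [E|rb] := eqVneq b (r 0%N).
  by exists 0%N, (lift ord0 ord0); left; rewrite /= ffunE.
apply: (works_captured play (t := 0%N) _ _ wp) => //.
by rewrite !inE negb_or ![r 0%N == _]eq_sym ra rb.
Qed.

Lemma win_sub a b K K' : (forall r, K r -> K' r) -> win a b K' -> win a b K.
Proof.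
move=> sK w; elim: w K sK => {a b K'} [a b K' nK K sK|a b K' a' b' sa sb _ IH K sK].
  by apply: WinEmpty => r /sK /nK.
apply: (WinMove sa sb) => o; apply: (IH o) => r [[r0 [/sK Kr0 n0 m n1]] so].
by split=> //; exists r0.
Qed.

Lemma hiddenC a b r : hidden a b r = hidden b a r.
Proof. by rewrite /hidden andbC. Qed.

Lemma win_sym a b K : win a b K -> win b a K.
Proof.
elim=> {a b K} [a b K nK|a b K a' b' sa sb _ IH]; first exact: WinEmpty.
apply: (WinMove sb sa) => o; apply: win_sub (IH o) => r [[r0 [K0 n0 m n1]] so].
split; last by rewrite /sight hiddenC.
by exists r0; split; rewrite // !inE orbC -?[_ || _]/(_ \in [:: _; _]); move: n0 n1; rewrite !inE.
Qed.

Lemma win_look a b K a' b' K' : stay_or_move a a' -> stay_or_move b b' ->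
  (forall r, after K a' b' r -> K' r) ->
  win a' b' (fun r => K' r /\ hidden a' b' r) ->
  (forall v, K' v -> win a' b' (eq v)) -> win a b K.
Proof.
move=> sa sb sK wh wv; apply: (WinMove sa sb) => -[v|].
  case: (pselect (K' v)) => [/wv|nK].
    by apply: win_sub => r [_]; rewrite /sight; case: ifP => // _ [].
  apply: WinEmpty => r [/sK Kr]; rewrite /sight; case: ifP => // _ [E].
  by apply: nK; rewrite -E.
by apply: win_sub wh => r [/sK Kr]; rewrite /sight; case: ifP.
Qed.

(** If the robber cannot be invisible in [Q], the cops learn whether he is in [Q]. *)
Lemma win_split (Q : pred G) a b K a' b' K' : stay_or_move a a' -> stay_or_move b b' ->
  (forall r, after K a' b' r -> K' r) ->
  (forall r, K' r -> Q r -> ~~ hidden a' b' r) ->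
  win a' b' (fun r => K' r /\ Q r) -> win a' b' (fun r => K' r /\ ~~ Q r) ->
  win a b K.
Proof.
move=> sa sb sK vis wq wn; apply: (win_look sa sb sK).
  apply: win_sub wn => r [Kr hr]; split=> //.
  by apply/negP => /(vis _ Kr); rewrite hr.
move=> v Kv; have [qv|nqv] := boolP (Q v).
  by apply: win_sub wq => r <-.
by apply: win_sub wn => r <-.
Qed.

Lemma win_step a b K a' b' K' : stay_or_move a a' -> stay_or_move b b' ->
  (forall r, after K a' b' r -> K' r) -> win a' b' K' -> win a b K.
Proof.
move=> sa sb sK w; apply: (win_look sa sb sK).
  by apply: win_sub w => r [].
by move=> v Kv; apply: win_sub w => r <-.
Qed.

End Knowledge.

(** * Regions bounded by two cops *)

Section Regions.
Variable G : sgraph.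
Implicit Types (a b u v r x y z : G) (s t : seq G).

Definition within2 u v : bool := adj u v || [exists r, adj u r && adj r v].

(** When there is no path [gdist] is [#|G|], whence the hypothesis. *)
Lemma gdist_within2 u v : (2 < #|G|)%N -> (1 <= gdist u v <= 2)%N -> within2 u v.
Proof.
move=> G3; rewrite /gdist /within2; set P := (fun n : nat => _) => /andP[d1 d2].
have hP : has P (iota 0 #|G|) by rewrite has_find size_iota (leq_ltn_trans d2).
have := nth_find 0 hP; rewrite nth_iota; last by rewrite (leq_ltn_trans d2).
rewrite add0n; move: d1 d2; case: (find P _) => [|[|[|n]]] // _ _ /existsP[p].
  case: p => [[|x [|? ?]] //= _]; rewrite andbT => /andP[ux /eqP <-].
  by rewrite ux.
case: p => [[|x [|y [|? ?]]] //= _]; rewrite andbT => /andP[/andP[ux xy] /eqP <-].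
by apply/orP; right; apply/existsP; exists x; rewrite ux.
Qed.

(** All that will be used about invisibility. The three vertices make [G] large
    enough for [gdist_within2]. *)
Lemma hidden_within2 a b r x y z : uniq [:: x; y; z] -> hidden a b r ->
  within2 r a /\ within2 r b.
Proof.
move=> xyz; have G3 : (2 < #|G|)%N.
  by rewrite (leq_trans _ (max_card (mem [:: x; y; z]))) // (card_uniqP xyz).
by case/andP=> /(gdist_within2 G3) ra /(gdist_within2 G3).
Qed.

Definition guarded a b s : Prop :=
  forall r v, r \in s -> adj r v -> v \in [:: a, b & s].

Definition region a b s : Prop :=
  [/\ uniq (a :: rcons s b), noncrossing adj (a :: rcons s b) & guarded a b s].

Lemma noncrossing_sub s t : subseq s t -> noncrossing (@adj G) t -> noncrossing adj s.
Proof. by move=> st nt x y z w sx; apply: nt; apply: subseq_trans st. Qed.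

Lemma noncrossing_rev s : noncrossing (@adj G) s -> noncrossing adj (rev s).
Proof.
move=> ns x y z t; rewrite -[[:: x; _; _; _]]revK subseq_rev => sx xz yt.
by apply: (ns _ _ _ _ sx); rewrite adj_sym.
Qed.

Lemma region_rev a b s : region a b s -> region b a (rev s).
Proof.
have E : b :: rcons (rev s) a = rev (a :: rcons s b) by rewrite rev_cons rev_rcons.
case=> us ns gs; split; rewrite ?E ?rev_uniq //; first exact: noncrossing_rev.
move=> r v; rewrite mem_rev => rs rv; have := gs r v rs rv.
by rewrite !inE mem_rev orbCA.
Qed.

(** A chord from [a] to [u] hides [s1] from what comes after [u]. *)
Lemma not_crossing a b s1 u s2 r v : noncrossing (@adj G) (a :: rcons (s1 ++ u :: s2) b) ->
  adj a u -> r \in s1 -> v \in rcons s2 b -> adj r v -> False.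
Proof.
move=> nc au rs vs; apply: nc au.
rewrite /= eqxx rcons_cat; apply: (@cat_subseq _ [:: r] [:: u; v]); first by rewrite sub1seq.
by rewrite /= eqxx sub1seq.
Qed.

Lemma region_left a b s1 u s2 : region a b (s1 ++ u :: s2) -> adj a u -> region a u s1.
Proof.
move=> [us nc gs] au.
have sub : subseq (a :: rcons s1 u) (a :: rcons (s1 ++ u :: s2) b).
  rewrite /= eqxx rcons_cat -cats1; apply: cat_subseq => //=.
  by rewrite eqxx sub0seq.
split; [exact: subseq_uniq us|exact: noncrossing_sub nc|].
move=> r v rs rv; have := gs r v _ rv; rewrite !inE mem_cat rs => /(_ isT).
rewrite mem_cat inE; case/or4P => [->//|/eqP E|->|/orP[->|vs2]]; rewrite ?orbT //.
  by case: (not_crossing nc au rs _ rv); rewrite E mem_rcons mem_head.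
by case: (not_crossing nc au rs _ rv); rewrite mem_rcons inE vs2 orbT.
Qed.

Lemma region_right a b s1 u s2 : region a b (s1 ++ u :: s2) -> adj a u ->
  ~~ has (adj a) s2 -> region u b s2.
Proof.
move=> [us nc gs] au /hasPn ns2.
have sub : subseq (u :: rcons s2 b) (a :: rcons (s1 ++ u :: s2) b).
  by rewrite rcons_cat -cat_cons; apply: suffix_subseq.
split; [exact: subseq_uniq us|exact: noncrossing_sub nc|].
move=> r v rs rv; have := gs r v _ rv; rewrite !(inE, mem_cat) rs !orbT => /(_ isT).
case/or4P => [/eqP E|->|vs1|/orP[->|->]]; rewrite ?orbT //.
  by have := ns2 _ rs; rewrite -E adj_sym rv.
by case: (@not_crossing a b s1 u s2 v r) => //; rewrite 1?mem_rcons 1?inE 1?rs ?orbT // adj_sym.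
Qed.

Lemma region_right' a b s1 u s2 : region a b (s1 ++ u :: s2) -> adj u b -> region u b s2.
Proof.
move=> /region_rev; rewrite rev_cat rev_cons cat_rcons => R ub.
have := region_left R; rewrite adj_sym => /(_ ub) /region_rev.
by rewrite revK.
Qed.

Lemma region_left' a b s1 u s2 : region a b (s1 ++ u :: s2) -> adj u b ->
  ~~ has (adj b) s1 -> region a u s1.
Proof.
move=> /region_rev; rewrite rev_cat rev_cons cat_rcons => R ub; rewrite -has_rev => nb.
have := region_right R; rewrite adj_sym => /(_ ub nb) /region_rev.
by rewrite revK.
Qed.

Lemma first_split (e : pred G) s : has e s ->
  exists s1 u s2, [/\ s = s1 ++ u :: s2, e u & ~~ has e s1].
Proof. by case/split_find => u s1 s2 eu ns; exists s1, u, s2; rewrite cat_rcons. Qed.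

Lemma last_split (e : pred G) s : has e s ->
  exists s1 u s2, [/\ s = s1 ++ u :: s2, e u & ~~ has e s2].
Proof.
rewrite -has_rev => /first_split[s1 [u [s2 [E eu ns]]]].
exists (rev s2), u, (rev s1); split; rewrite ?has_rev //.
by rewrite -[s]revK E rev_cat rev_cons cat_rcons.
Qed.

Lemma subseq_cat_split (q s t : seq G) : subseq q (s ++ t) ->
  exists q1 q2 : seq G, [/\ q = q1 ++ q2, subseq q1 s & subseq q2 t].
Proof.
case/subseqP=> m sm ->.
exists (mask (take (size s) m) s), (mask (drop (size s) m) t); split; rewrite ?mask_subseq //.
rewrite -mask_cat ?cat_take_drop // size_takel //.
by rewrite sm size_cat leq_addr.
Qed.

(** If all edges that leave the block [s2] end in [u], then [u] can be moved from
    the front of the block to its end: an edge between [u] and the block turns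
    around without meeting the edges inside it. *)
Lemma noncrossing_rotate a s1 u s2 : uniq (a :: s1 ++ u :: s2) ->
  noncrossing (@adj G) (a :: s1 ++ u :: s2) ->
  (forall r v, r \in s2 -> adj r v -> v \in u :: s2) ->
  noncrossing adj (a :: rcons (s1 ++ s2) u).
Proof.
move=> us nc gs x y z t.
have far v r : v \in a :: s1 -> r \in s2 -> adj v r -> False.
  move=> va rs; rewrite adj_sym => /(gs _ _ rs) vu; move: us.
  by rewrite -cat_cons cat_uniq => /and3P[_ /hasPn/(_ _ vu)]; rewrite /= va.
rewrite -rcons_cons -cats1 => /subseq_cat_split[x1 [x2 [E sx1 sx2]]] xz yt.
have sub : subseq (a :: s1 ++ s2) (a :: s1 ++ u :: s2).
  by rewrite /= eqxx cat_subseq ?subseq_cons.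
case: x2 E sx2 => [|t' [|? ?]] E; last by move/size_subseq.
- rewrite cats0 in E => _.
  rewrite -E in sx1; apply: nc xz yt; exact: subseq_trans sx1 sub.
- rewrite sub1seq mem_seq1 => /eqP t'E; rewrite {t'}t'E in E.
  have [Ex Et] : x1 = [:: x; y; z] /\ t = u.
    by move: E; case: x1 {sx1} => [|? [|? [|? [|? [|? ?]]]]] // [-> -> -> ->].
  subst t; move: sx1; rewrite Ex -cat_cons.
  case/subseq_cat_split => z1 [z2 [Ez sz1 sz2]].
  (* The edge xz has both ends in s2 or both ends before u. *)
  case: z1 Ez sz1 => [|x' [|y' [|z' [|? ?]]]] //.
  + rewrite cat0s => Ez _; apply: (nc u x y z) => //; last by rewrite adj_sym.
    rewrite -Ez in sz2; rewrite -cat_cons.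
    by apply: (@cat_subseq _ [::] [:: u; x; y; z]); rewrite ?sub0seq //= eqxx.
  + case=> <- Ez sz1; case: (@far x z) => //; first by rewrite -sub1seq.
    by rewrite -sub1seq; apply: subseq_trans sz2; rewrite -Ez sub1seq mem_seq2 eqxx orbT.
  + case=> <- <- Ez sz1; case: (@far x z) => //.
      by apply: (mem_subseq sz1); rewrite mem_head.
    by rewrite -sub1seq; apply: subseq_trans sz2; rewrite -Ez.
  + case=> <- <- <- _ sz1; apply: (nc x y z u) => //.
    by rewrite -cat_cons; apply: (@cat_subseq _ [:: x; y; z] [:: u]); rewrite ?sub1seq ?mem_head.
Qed.
End Regions.

(** * Moves that shrink a region *)

Section Sweep.
Variable G : sgraph.
Implicit Types (a b u v w r x y z p : G) (s t : seq G) (K : G -> Prop).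

Definition among s r : Prop := r \in s.

Definition clears_below n : Prop :=
  forall a b s, (size s < n)%N -> region a b s -> win a b (among s).

Lemma stay a : stay_or_move a a.
Proof. by rewrite /stay_or_move eqxx. Qed.

Lemma move_to a b : adj a b -> stay_or_move a b.
Proof. by rewrite /stay_or_move => ->; rewrite orbT. Qed.

Lemma after_among K x y t :
  (forall r, K r -> r \notin [:: x; y] -> r \in t) ->
  (forall r v, K r -> r \notin [:: x; y] -> adj r v -> v \in [:: x, y & t]) ->
  forall r, after K x y r -> among t r.
Proof.
move=> Kt Kn v [r [Kr nr /orP[/eqP->|rv] nv]]; first exact: Kt.
have := Kn _ _ Kr nr rv; move: nv; rewrite /among !inE negb_or => /andP[/negPf-> /negPf->].
by [].
Qed.

Lemma win_among n a b c d K s : clears_below n -> (size s < n)%N ->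
  region a b s -> stay_or_move c a -> stay_or_move d b ->
  (forall r, K r -> r \notin [:: a; b] -> r \in s) -> win c d K.
Proof.
move=> cl sn R ca db Ks; apply: (win_step ca db _ (cl _ _ _ sn R)).
apply: after_among => // r v Kr nr rv; case: R => _ _; apply; last exact: rv.
exact: Ks.
Qed.

(** This serves for a lone guard [a] and, in the reversed order, for a cop whose
    only neighbour in the region is [u]. *)
Lemma region_rotate a s1 u s2 : uniq (a :: s1 ++ u :: s2) ->
  noncrossing adj (a :: s1 ++ u :: s2) ->
  (forall r v, r \in s1 ++ s2 -> adj r v -> v \in a :: s1 ++ u :: s2) ->
  (forall r v, r \in s2 -> adj r v -> v \in u :: s2) ->
  region a u (s1 ++ s2).
Proof.
move=> us nc gs g2; split.
- rewrite -(perm_uniq (_ : perm_eq (a :: s1 ++ u :: s2) _)) //.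
  by rewrite perm_cons rcons_cat perm_cat2l perm_sym perm_rcons.
- exact: noncrossing_rotate.
by move=> r v rs rv; have := gs r v rs rv; rewrite !(inE, mem_cat); case/or4P => ->; rewrite ?orbT.
Qed.

(** While [a] alone confines the robber, the other cop goes where he likes. *)
Lemma win_walk a b c K K1 : connect adj b c ->
  (forall y r, after K a y r -> K r) -> (forall r, after K a c r -> K1 r) ->
  win a c K1 -> win a b K.
Proof.
case/connectP=> q; elim: q b => [|b' q IH] b /=.
  by move=> _ -> sK sK1 wc; apply: (win_step (stay a) (stay _) sK1 wc).
case/andP=> bb' qb' cE sK sK1 wc.
apply: (win_step (stay a) (move_to bb') (sK b')).
exact: IH.
Qed.

(** A path from [s] to [a] must leave [s], and can only do so into [a]. *)
Lemma exit_of_connected a s : (forall x y, connect (@adj G) x y) -> a \notin s ->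
  s != [::] -> (forall r v, r \in s -> adj r v -> v \in a :: s) -> has (adj a) s.
Proof.
move=> conn as_ s0 gs; apply/negPn/negP => /hasPn na.
case: s s0 as_ gs na => // x s _ as_ gs na.
case/connectP: (conn x a) => q.
have : x \in x :: s by rewrite mem_head.
elim: q {1 3 4}x => [|y q IH] z zs /=; first by move=> _ E; rewrite E zs in as_.
case/andP=> zy pq; apply: IH pq.
have := gs _ _ zs zy; rewrite inE => /predU1P[E|//].
by have := na _ zs; rewrite -E adj_sym zy.
Qed.

(** One cop guards the cut vertex [a]; the other one walks to the last neighbour
    [u] of [a] in [s], and [region_rotate] gives a region with one vertex less. *)
Lemma win_cut n a b s : (forall x y, connect (@adj G) x y) -> clears_below n ->
  (size s <= n)%N -> uniq (a :: s) -> noncrossing adj (a :: s) ->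
  (forall r v, r \in s -> adj r v -> v \in a :: s) -> win a b (among s).
Proof.
move=> conn cl sn us nc gs.
have [->|s0] := eqVneq s [::]; first exact: WinEmpty.
have as_ : a \notin s by case/andP: us.
case/last_split: (exit_of_connected conn as_ s0 gs) => s1 [u [s2 [sE au ns2]]].
subst s.
have g2 r v : r \in s2 -> adj r v -> v \in u :: s2.
  move=> rs rv; have := gs r v _ rv; rewrite !(inE, mem_cat) rs !orbT => /(_ isT).
  case/or4P => [/eqP E|vs1|->|->]; rewrite ?orbT //.
    by have := hasPn ns2 _ rs; rewrite -E adj_sym rv.
  exfalso; apply: (nc a v u r) => //; last by rewrite adj_sym.
  rewrite /= eqxx; apply: (@cat_subseq _ [:: v] [:: u; r]); first by rewrite sub1seq.
  by rewrite /= eqxx sub1seq.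
have R : region a u (s1 ++ s2).
  apply: region_rotate => // r v rs; apply: gs; move: rs.
  by rewrite !mem_cat inE => /orP[]->; rewrite ?orbT.
have w : win a u (among (s1 ++ s2)).
  by apply: cl R; move: sn; rewrite !size_cat /= addnS.
apply: (win_walk (conn b u) _ _ w).
  move=> y r; apply: after_among => // r' v rs _ rv.
  by have := gs r' v rs rv; rewrite !inE => /orP[->|->]; rewrite ?orbT.
apply: after_among => [r|r v rs _ rv].
  rewrite /among !(inE, mem_cat) negb_or => /or3P[->//|->|->]; rewrite ?andbF ?orbT //.
by have := gs r v rs rv; rewrite !(inE, mem_cat) => /or4P[]->; rewrite ?orbT.
Qed.
End Sweep.

Section Clearing.
Variable G : sgraph.
Implicit Types (a b u v w r x y z p : G) (s t X : seq G) (K : G -> Prop).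

(** A path of length two from one side of [w] to the other goes through [w], since
    a path through [a] and [b] has length three. *)
Lemma within2_across a w X b t p r : region a w X -> region w b t ->
  uniq (a :: rcons (X ++ w :: t) b) -> p \in X -> r \in t -> within2 p r -> adj p w.
Proof.
move=> [_ _ gX] [_ _ gt] us pX rt.
have sep z : z \in [:: a & X] -> z \notin [:: w, b & t].
  move=> zX; apply/negP => zt; move: us.
  rewrite rcons_cat -cat_cons cat_uniq => /and3P[_ /hasPn/(_ z) /= nz _].
  by move: zX; apply/negP; apply: nz; move: zt; rewrite !inE mem_rcons inE.
case/orP => [pr|/existsP[z /andP[pz zr]]].
  have := gX _ _ pX pr; have := sep r; rewrite !inE rt !orbT /= => h.
  case/or3P => [/eqP E|/eqP E|rX]; [|by rewrite -E|]; exfalso.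
    by have := h; rewrite E eqxx => /(_ isT).
  by have := h; rewrite rX orbT => /(_ isT).
have zt := gt r z rt; rewrite adj_sym zr in zt; move/(_ isT): zt => zt.
have := gX _ _ pX pz; rewrite inE => /predU1P[E|]; last rewrite inE => /predU1P[<-//|zX].
  by have := sep z; rewrite zt E mem_head => /(_ isT).
by have := sep z; rewrite zt inE zX orbT => /(_ isT).
Qed.

(** While the cop is at [p], the robber is visible in all of [t]. He may meanwhile
    enter [a], but is caught there when the cop returns; and if he was not in [t]
    the other cop takes [w] at the same time. *)
Lemma win_feint a b p X w t : region a b (X ++ w :: t) -> region a w X -> region w b t ->
  adj a p -> p \in X -> ~~ adj p w -> adj w b ->
  win a w (among X) -> win a b (among (w :: t)) -> win a b (among (X ++ w :: t)).
Proof.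
move=> R RX Rt ap pX pw wb wX wt; have [us _ gs] := R; have [uX _ gX] := RX; have [_ _ gt] := Rt.
apply: (@win_split _ (mem t) a b _ p b (among (a :: X ++ w :: t))).
- exact: move_to.
- exact: stay.
- apply: after_among => r; first by move=> rs _; rewrite inE; apply/orP; right.
  by move=> v rs _ rv; have := gs _ _ rs rv; rewrite !inE; case/or3P=> ->; rewrite ?orbT.
- move=> r _ rt; apply/negP => h.
  have u3 : uniq [:: a; p; w].
    apply: subseq_uniq uX; rewrite /= eqxx -cats1.
    by apply: (@cat_subseq _ [:: p] [:: w]); rewrite sub1seq ?mem_head.
  have [+ _] := hidden_within2 u3 h; rewrite /within2 => rp.
  have : within2 p r.
    case/orP: rp => [|/existsP[z /andP[z1 z2]]]; first by rewrite /within2 adj_sym => ->.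
    by apply/orP; right; apply/existsP; exists z; rewrite adj_sym z2 adj_sym z1.
  by move/(within2_across RX Rt us pX rt); rewrite (negPf pw).
- apply: (@win_step _ p b _ a b (among (w :: t))) => //; first by rewrite move_to // adj_sym.
    exact: stay.
  apply: after_among => [r [_ rt] _|r v [_ rt] _ rv]; first by rewrite inE; apply/orP; right.
  by have := gt _ _ rt rv; rewrite !inE => /or3P[]->; rewrite ?orbT.
apply: (@win_step _ p b _ a w (among X)) => //; first by rewrite move_to // adj_sym.
  by rewrite move_to // adj_sym.
have inX r : among (a :: X ++ w :: t) r /\ r \notin mem t -> r \notin [:: a; w] -> r \in X.
  move=> [rK nt]; rewrite !inE negb_or => /andP[/negPf ra /negPf rw].
  by move: rK; rewrite /among inE ra mem_cat inE rw /= => /orP[//|rt]; case/negP: nt.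
apply: after_among => // r v rK nr rv; have := inX _ rK nr => rX.
by have := gX _ _ rX rv.
Qed.

Section Fan.
Variables (n : nat) (u b : G) (s2 : seq G).
Hypothesis cl : clears_below G n.
Hypothesis R2 : region u b s2.
Hypothesis ub : adj u b.

(** Together with [fan_near']: the robber is invisible to cops at [x] and [b] only
    at [u] and at neighbours of [u]. *)
Lemma fan_near x s1 r : region x u s1 -> uniq (x :: rcons (s1 ++ u :: s2) b) ->
  (adj x b -> forall r, r \in s1 -> adj r x -> adj r u) ->
  r \in s1 -> within2 r b -> adj r u.
Proof.
move=> [_ _ g1] us H rs.
have nb : b \notin [:: x, u & s1].
  move: us; rewrite -rcons_cons rcons_uniq => /andP[+ _].
  by rewrite !(inE, mem_cat) !negb_or => /and4P[-> -> -> _].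
case/orP=> [rb|/existsP[z /andP[rz zb]]].
  by have := g1 _ _ rs rb; rewrite (negPf nb).
have := g1 _ _ rs rz; rewrite !inE => /or3P[/eqP E|/eqP <-//|zs].
  by apply: H rs _; rewrite -E.
by have := g1 _ _ zs zb; rewrite (negPf nb).
Qed.

Lemma fan_near' x s1 r : region x u s1 -> uniq (x :: rcons (s1 ++ u :: s2) b) ->
  (adj x b -> forall r, r \in s2 -> adj r b -> adj r u) ->
  r \in s2 -> within2 r x -> adj r u.
Proof.
move=> R1 us H rs; have [_ _ g2] := R2.
have nx : x \notin [:: u, b & s2].
  case/andP: us => + _; rewrite mem_rcons !(inE, mem_cat) !negb_or.
  by case/and4P=> -> _ -> ->.
case/orP=> [rb|/existsP[z /andP[rz zx]]].
  by have := g2 _ _ rs rb; rewrite (negPf nx).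
have := g2 _ _ rs rz; rewrite !inE => /or3P[/eqP <-//|/eqP E|zs].
  by rewrite E in rz zx; apply: H rs rz; rewrite adj_sym.
by have := g2 _ _ zs zx; rewrite (negPf nx).
Qed.

(** The vertices before [x] are already clear, but [u] may have neighbours there,
    so [x], [u], [s1], [s2], [b] do not form a region: a robber at [u] threatens
    to escape. The cops come back from [x], [b] to [u] whenever the robber may
    have gone there, and advance from [x] to the next neighbour [x'] of [u]. If
    the robber becomes visible he is caught or confined to [s1] or to [s2]. *)
Lemma win_fan k : forall x s1, (size s1 < k)%N ->
  region x u s1 -> uniq (x :: rcons (s1 ++ u :: s2) b) ->
  (size (s1 ++ u :: s2) <= n)%N -> adj x u ->
  (adj x b -> forall r, r \in s1 -> adj r x -> adj r u) ->
  (adj x b -> forall r, r \in s2 -> adj r b -> adj r u) ->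
  forall c d K, stay_or_move c x -> stay_or_move d b ->
    (forall r, after K x b r -> among (s1 ++ u :: s2) r) -> win c d K.
Proof.
elim: k => // k IH x s1 sk R1 us sn xu H1 H2 c d K cx db sK.
have [u1 n1 g1] := R1; have [_ _ g2] := R2.
have n1' : (size s1 < n)%N by apply: leq_trans sn; rewrite size_cat /= addnS ltnS leq_addr.
have n2' : (size s2 < n)%N by apply: leq_trans sn; rewrite size_cat /= addnS ltnS leq_addl.
have u3 : uniq [:: x; u; b].
  apply: subseq_uniq us; rewrite /= eqxx -cats1 -catA.
  apply: (@cat_subseq _ [::] [:: u; b]); rewrite ?sub0seq //= eqxx.
  by rewrite sub1seq mem_cat mem_head orbT.
have bu : stay_or_move b u by rewrite move_to // adj_sym.
have ux : stay_or_move u x by rewrite move_to // adj_sym.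
apply: (win_look cx db sK); last first.
  move=> v; rewrite /among mem_cat => /orP[v1|].
    apply: (win_among cl n1' R1 _ bu); first exact: stay.
    by move=> r <-.
  rewrite inE => v2.
  apply: (win_among cl n2' R2 (move_to xu)); first exact: stay.
  move=> r <-; rewrite inE negb_or => /andP[/negPf vu _].
  by move: v2; rewrite vu.
pose K1 r := among (s1 ++ u :: s2) r /\ (r = u \/ adj r u).
apply: (@win_sub _ _ _ _ K1).
  move=> r [rs h]; split=> //; have [nx nb] := hidden_within2 u3 h.
  move: rs; rewrite /among mem_cat inE => /or3P[r1|/eqP->|r2]; [right|by left|right].
    exact: fan_near R1 us H1 r1 nb.
  exact: fan_near' R1 us H2 r2 nx.
case: (boolP (has (adj u) s1)) => [|ns1]; last first.
  apply: (win_among cl n2' R2 (move_to xu)); first exact: stay.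
  move=> r [+ ru]; rewrite /among mem_cat !inE negb_or => + /andP[/negPf nu _].
  rewrite nu => /orP[r1|//]; case: ru => [E|ru]; first by rewrite E eqxx in nu.
  by have := hasPn ns1 _ r1; rewrite adj_sym ru.
case/first_split=> z1 [x' [z2 [s1E ux' nz1]]].
have R1' : region x' u z2.
  by apply: (@region_right' _ x u z1 x'); rewrite -?s1E // adj_sym.
have [u1' _ g1'] := R1'.
have xb' : ~~ adj x' b.
  apply/negP => h; have x's : x' \in s1 by rewrite s1E mem_cat mem_head orbT.
  have := g1 _ _ x's h; rewrite !inE.
  move: us; rewrite -rcons_cons rcons_uniq => /andP[+ _].
  by rewrite !(inE, mem_cat) !negb_or => /and4P[/negPf-> /negPf-> /negPf-> _].
have us' : uniq (x' :: rcons (z2 ++ u :: s2) b).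
  apply: subseq_uniq us; rewrite s1E -catA !rcons_cat.
  exact: (suffix_subseq (x :: z1) (x' :: z2 ++ rcons (u :: s2) b)).
have sz2 : (size z2 < size s1)%N by rewrite s1E size_cat /= addnS ltnS leq_addl.
have fan' : forall c d K, stay_or_move c x' -> stay_or_move d b ->
    (forall r, after K x' b r -> among (z2 ++ u :: s2) r) -> win c d K.
  apply: IH => //.
  - exact: leq_trans sz2 _.
  - by apply: leq_trans sn; rewrite !size_cat leq_add2r ltnW.
  - by rewrite adj_sym.
  - by rewrite (negPf xb').
  - by rewrite (negPf xb').
have in_z2 r : r \in s1 -> adj r u -> r = x' \/ r \in z2.
  rewrite s1E mem_cat inE => /or3P[r1|/eqP->|->] ru; [|by left|by right].
  by have := hasPn nz1 _ r1; rewrite adj_sym ru.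
have fan_end K' : (forall r, K' r -> r \in z2 \/ r = x' \/ r \in s2) -> win u b K'.
  move=> K'E; apply: fan' (move_to ux') (stay b) _.
  apply: after_among => [r Kr|r v Kr].
    rewrite !inE mem_cat inE negb_or => /andP[nx _].
    by case: (K'E _ Kr) nx => [->|[->|->]]; rewrite ?eqxx ?orbT.
  rewrite !inE negb_or => /andP[nx _] rv.
  case: (K'E _ Kr) nx => [rz|[->|rs]]; rewrite ?eqxx // => _.
    by have := g1' _ _ rz rv; rewrite !(inE, mem_cat) => /or3P[]->; rewrite ?orbT.
  by have := g2 _ _ rs rv; rewrite !(inE, mem_cat) => /or3P[]->; rewrite ?orbT.
(* If x and x' are adjacent, cops at u and b would let the robber slip from x'
   to x: the cops go through (x', u) and (u, b) to (x', b). Otherwise they go to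
   (u, b) first, where an invisible robber cannot be in z1. *)
have [xx'|xx'] := boolP (adj x x').
  apply: (@win_step _ x b _ x' u (among (z2 ++ rcons s2 b)) (move_to xx') bu).
    have K1E r : K1 r -> r \notin [:: x'; u] -> r \in z2 \/ r \in s2.
      case; rewrite /among mem_cat !inE negb_or => + ru /andP[/negPf nx' /negPf nu].
      rewrite nu /= => /orP[r1|->]; [left|by right].
      case: ru => [E|/(in_z2 _ r1)[E|//]]; first by rewrite E eqxx in nu.
      by rewrite E eqxx in nx'.
    apply: after_among => [r Kr nr|r v Kr nr rv].
      by rewrite mem_cat mem_rcons inE; case: (K1E _ Kr nr) => ->; rewrite ?orbT.
    rewrite !(inE, mem_cat) mem_rcons inE; case: (K1E _ Kr nr) => [rz|rs].
      by have := g1' _ _ rz rv; rewrite !inE => /or3P[]->; rewrite ?orbT.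
    by have := g2 _ _ rs rv; rewrite !inE => /or3P[]->; rewrite ?orbT.
  apply: (@win_step _ x' u _ u b (among (x' :: z2 ++ s2))).
  - by rewrite move_to // adj_sym.
  - exact: move_to.
  - have E r : among (z2 ++ rcons s2 b) r -> r \notin [:: u; b] -> r \in z2 \/ r \in s2.
      rewrite /among mem_cat mem_rcons !inE negb_or => + /andP[_ /negPf rb]; rewrite rb /=.
      by case/orP; [left|right].
    apply: after_among => [r Kr nr|r v Kr nr rv].
      by rewrite !(inE, mem_cat); case: (E _ Kr nr) => ->; rewrite ?orbT.
    rewrite !(inE, mem_cat); case: (E _ Kr nr) => [rz|rs].
      by have := g1' _ _ rz rv; rewrite !inE => /or3P[]->; rewrite ?orbT.
    by have := g2 _ _ rs rv; rewrite !inE => /or3P[]->; rewrite ?orbT.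
  apply: fan_end => r; rewrite /among !(inE, mem_cat).
  by case/or3P=> [/eqP|->|->]; [right; left|left|right; right].
apply: (@win_look _ x b _ u b (among (s1 ++ s2)) (move_to xu) (stay b)).
- have K1E r : K1 r -> r \notin [:: u; b] -> r \in s1 /\ adj r u \/ r \in s2.
    case; rewrite /among mem_cat !inE negb_or => + ru /andP[/negPf nu _].
    rewrite nu /= => /orP[r1|->]; [left|by right].
    by split=> //; case: ru => [E|//]; rewrite E eqxx in nu.
  apply: after_among => [r Kr nr|r v Kr nr rv].
    by rewrite mem_cat; case: (K1E _ Kr nr) => [[->//]|->]; rewrite orbT.
  rewrite !(inE, mem_cat); case: (K1E _ Kr nr) => [[r1 ru]|rs]; last first.
    by have := g2 _ _ rs rv; rewrite !inE => /or3P[]->; rewrite ?orbT.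
  have := g1 _ _ r1 rv; rewrite !inE => /or3P[/eqP E|->|->]; rewrite ?orbT //.
  have rx : adj x r by rewrite adj_sym -E.
  case: (in_z2 _ r1 ru) => [E'|rz]; first by rewrite -E' rx in xx'.
  exfalso; apply: (n1 x x' r u) => //; last by rewrite adj_sym.
  rewrite s1E /= eqxx rcons_cat.
  apply: (@cat_subseq _ [::] [:: x'; r; u]); rewrite ?sub0seq //= eqxx -cats1.
  by apply: (@cat_subseq _ [:: r] [:: u]); rewrite sub1seq ?mem_head.
- apply: fan_end => r [+ h]; rewrite /among mem_cat => /orP[r1|->]; last by right; right.
  have [_ nb] := hidden_within2 u3 h.
  by case: (in_z2 _ r1 (fan_near R1 us H1 r1 nb)) => [->|->]; [right; left|left].
move=> v; rewrite /among mem_cat => /orP[v1|v2].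
  by apply: (win_among cl n1' R1 ux bu) => r <-.
by apply: (win_among cl n2' R2 (stay u) (stay b)) => r <-.
Qed.
End Fan.
End Clearing.

(** * Two cops win *)

Section Win.
Variable G : sgraph.
Hypothesis conn : forall x y : G, connect adj x y.
Implicit Types (a b u v w r x y z p : G) (s t X : seq G) (K : G -> Prop).

Lemma win_rev a b s : win b a (among (rev s)) -> win a b (among s).
Proof. by move/win_sym; apply: win_sub => r; rewrite /among mem_rev. Qed.

Lemma region_cut n a b s : clears_below G n -> (size s <= n)%N -> region a b s ->
  ~~ has (adj b) s -> win a b (among s).
Proof.
move=> cl sn [us nc gs] nb; apply: (win_cut _ conn cl sn).
- by move: us; rewrite -rcons_cons rcons_uniq => /andP[].
- by apply: noncrossing_sub nc; rewrite -rcons_cons; apply: subseq_rcons.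
move=> r v rs rv; have := gs _ _ rs rv; rewrite !inE => /or3P[->//|/eqP E|->]; rewrite ?orbT //.
by have := hasPn nb _ rs; rewrite -E adj_sym rv.
Qed.

(** The robber in [s1] or in [s2] is told apart by a feint from [a] or, in the
    reversed order, from [b]; when there is none, [win_fan] applies. *)
Lemma win_chord n a b s1 u s2 : clears_below G n ->
  region a b (s1 ++ u :: s2) -> (size (s1 ++ u :: s2) <= n)%N ->
  adj a u -> adj u b -> win a b (among (s1 ++ u :: s2)).
Proof.
move=> cl R sn au ub.
have R1 : region a u s1 := region_left R au.
have R2 : region u b s2 := region_right' R ub.
have n1 : (size s1 < n)%N by apply: leq_trans sn; rewrite size_cat /= addnS ltnS leq_addr.
have n2 : (size s2 < n)%N by apply: leq_trans sn; rewrite size_cat /= addnS ltnS leq_addl.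
have [/hasP[p ps /andP[ap pu]]|/hasPn H1] := boolP (has (fun p => adj a p && ~~ adj p u) s1).
  apply: (win_feint R R1 R2 ap ps pu ub (cl _ _ _ n1 R1)).
  apply: (win_among cl n2 R2 (move_to au) (stay b)).
  by move=> r; rewrite /among !inE negb_or => /predU1P[->|//]; rewrite eqxx.
have [/hasP[q qs /andP[bq qu]]|/hasPn H2] := boolP (has (fun q => adj b q && ~~ adj q u) s2).
  apply: win_rev; have E : rev (s1 ++ u :: s2) = rev s2 ++ u :: rev s1.
    by rewrite rev_cat rev_cons cat_rcons.
  have Rr := region_rev R; rewrite E in Rr *.
  have R1r := region_rev R1; have R2r := region_rev R2.
  apply: (win_feint Rr R2r R1r bq _ qu) => //.
  - by rewrite mem_rev.
  - by rewrite adj_sym.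
  - by apply: cl => //; rewrite size_rev.
  apply: (win_among cl _ R1r); first by rewrite size_rev.
  - by rewrite move_to // adj_sym.
  - exact: stay.
  by move=> r; rewrite /among !inE negb_or => /predU1P[->|//]; rewrite eqxx.
have us : uniq (a :: rcons (s1 ++ u :: s2) b) by case: R.
apply: (win_fan cl R2 ub (ltnSn _) R1 us sn au _ _ (stay a) (stay b)).
- by move=> _ r rs ra; have := H1 _ rs; rewrite adj_sym ra /= negbK.
- by move=> _ r rs rb; have := H2 _ rs; rewrite adj_sym rb /= negbK.
case: R => _ _ gs; apply: after_among => // r v rs _; exact: gs.
Qed.

(** The last neighbour [u] of [a] comes strictly before the first neighbour [w] of
    [b], because edges do not cross; then every neighbour of [a] before [u] is at
    distance more than 2 from what lies beyond [w]. *)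
Lemma win_no_chord n a b s1 u s2 : clears_below G n ->
  region a b (s1 ++ u :: s2) -> (size (s1 ++ u :: s2) <= n)%N ->
  adj a u -> ~~ has (adj a) s2 -> has (adj a) s1 -> ~~ adj u b ->
  has (adj b) (s1 ++ u :: s2) -> win a b (among (s1 ++ u :: s2)).
Proof.
move=> cl R sn au ns2 /hasP[p ps ap] ub hb.
have [us nc gs] := R.
have R1 : region a u s1 := region_left R au.
have R2 : region u b s2 := region_right R au ns2.
have nb1 : ~~ has (adj b) s1.
  apply/hasPn => r rs; apply/negP => br.
  by apply: (not_crossing nc au rs (v := b)); rewrite ?mem_rcons ?mem_head // adj_sym.
have hb2 : has (adj b) s2 by move: hb; rewrite has_cat /= adj_sym (negPf nb1) (negPf ub).
case/first_split: hb2 => m1 [w [m2 [s2E bw nbm]]]; subst s2.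
have wb : adj w b by rewrite adj_sym.
have E : s1 ++ u :: m1 ++ w :: m2 = (s1 ++ u :: m1) ++ w :: m2 by rewrite -catA.
rewrite E in R sn us *.
have RX : region a w (s1 ++ u :: m1).
  apply: (region_left' R wb); rewrite has_cat /= adj_sym (negPf nb1) (negPf ub).
  exact: nbm.
have Rt : region w b m2 := region_right' R wb.
have sz1 : (size (s1 ++ u :: m1) < n)%N.
  by apply: leq_trans sn; rewrite [X in (_ < X)%N]size_cat [size (w :: m2)]/= addnS ltnS leq_addr.
have sz2 : (size (m1 ++ w :: m2) < n)%N.
  by apply: leq_trans sn; rewrite -catA [X in (_ < X)%N]size_cat; apply: leq_addl.
apply: (win_feint R RX Rt ap _ _ wb) => //.
- by rewrite mem_cat ps.
- apply/negP => pw; case: R1 => _ _ g1; have := g1 _ _ ps pw.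
  move: us; rewrite rcons_cat -cat_cons cat_uniq => /and3P[_ /hasPn/(_ w) /= + _].
  rewrite mem_head !(inE, mem_cat) !negb_or => /(_ isT) /and4P[/negPf-> /negPf-> /negPf-> _].
  by [].
- exact: cl.
apply: (win_among cl sz2 R2 (move_to au) (stay b)) => r.
by rewrite /among mem_cat => ->; rewrite orbT.
Qed.

(** Strong induction on the size of the region. *)
Lemma win_region n : clears_below G n.
Proof.
elim: n => // n cl a b s; rewrite ltnS => sn R.
have [ha|na] := boolP (has (adj a) s); last first.
  apply: win_rev; apply: (region_cut cl) (region_rev R) _; first by rewrite size_rev.
  by rewrite has_rev.
have [hb|nb] := boolP (has (adj b) s); last exact: (region_cut cl).
case/last_split: ha => s1 [u [s2 [sE au ns2]]]; subst s.
have [ha1|na1] := boolP (has (adj a) s1).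
  have [ub|ub] := boolP (adj u b); first exact: (win_chord cl).
  exact: (win_no_chord cl).
have [us nc gs] := R; have [_ _ g1] := region_left R au.
have Erev : rev (u :: rcons (s1 ++ s2) b) = b :: rcons (rev s2 ++ rev s1) u.
  by rewrite rev_cons rev_rcons rev_cat.
have R' : region u b (s1 ++ s2).
  rewrite -[s1 ++ s2]revK rev_cat; apply: region_rev.
  have sub : subseq (b :: rev s2 ++ u :: rev s1) (rev (a :: rcons (s1 ++ u :: s2) b)).
    by rewrite rev_cons rev_rcons rev_cat rev_cons cat_rcons; apply: subseq_rcons.
  apply: region_rotate.
  - by apply: subseq_uniq sub _; rewrite rev_uniq.
  - exact: noncrossing_sub sub (noncrossing_rev nc).
  - move=> r v; rewrite mem_cat !mem_rev => rs rv.
    have rs' : r \in s1 ++ u :: s2 by rewrite mem_cat inE; case/orP: rs => ->; rewrite ?orbT.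
    have := gs _ _ rs' rv; rewrite !(inE, mem_cat, mem_rev).
    case/or3P => [/eqP E|->//|/or3P[]->]; rewrite ?orbT //.
    case/orP: rs => rs; [have := hasPn ns2 _ rs|have := hasPn na1 _ rs].
      by rewrite -E adj_sym rv.
    by rewrite -E adj_sym rv.
  move=> r v; rewrite !(mem_rev, inE) => rs rv; have := g1 _ _ rs rv.
  rewrite !inE => /or3P[/eqP E|->//|->]; rewrite ?orbT //.
  by have := hasPn na1 _ rs; rewrite -E adj_sym rv.
apply: (win_among cl _ R' (move_to au) (stay b)).
  by move: sn; rewrite !size_cat /= addnS.
by move=> r; rewrite /among !(inE, mem_cat) negb_or => /or3P[->//|->|->]; rewrite ?orbT.
Qed.

Lemma cops_win_of_noncrossing (l : seq G) : uniq l -> (forall v, v \in l) ->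
  noncrossing adj l -> (0 < #|G|)%N -> cops_win G 2 2.
Proof.
move=> ul all_l nc /card_gt0P[x _].
case: l ul all_l nc => [_ /(_ x)//|a s us all_s nc].
apply: (@cops_win_of_win _ a a); apply: (@win_sub _ _ _ _ (among s)).
  move=> r; rewrite /among !inE orbb => /negPf ra.
  by have := all_s r; rewrite inE ra.
exact: (win_cut _ conn (@win_region _) (leqnn _)).
Qed.

Lemma hyperopic_le (k m : nat) : cops_win G k m -> (hyperopic_cop_number G k <= m)%N.
Proof.
move=> w; rewrite /hyperopic_cop_number; case: ex_minnP => j _; apply.
exact/asboolP.
Qed.
End Win.

Theorem theorem5p1 (R : realType) (G : sgraph) (hconn : connected_graph G)
    (houter : outerplanar R G) :
  (hyperopic_cop_number G 2 <= 2)%N.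
Proof.
case: hconn => G0 conn; have [l [ul all_l nc]] := outerplanar_noncrossing houter.
exact/hyperopic_le/(cops_win_of_noncrossing conn ul all_l nc G0).
Qed.
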